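(* Let $F=F(N,\mathcal{D})$ be a non-fragile connected generalized Sierpiński carpet, and let $C_F$ be the set of cut points of $F$. If $\#C_F\geq 2$, then $C_F$ is infinite.
   Context: Let $N\geq 2$ and $\mathcal{D}\subset\{0,1,\ldots,N-1\}^2$ with $1<|\mathcal{D}|<N^2$. For $i\in\mathcal{D}$ let $\varphi_i(x)=\frac1N(x+i)$, $x\in\mathbb{R}^2$. The generalized Sierpiński carpet (GSC) $F=F(N,\mathcal{D})$ is the unique non-empty compact set with $F=\bigcup_{i\in\mathcal{D}}\varphi_i(F)$. A point $x$ of a connected topological space $X$ is a cut point of $X$ if $X\setminus\{x\}$ is disconnected. A connected GSC $F$ is called fragile if there is a decomposition $\mathcal{D}=\mathcal{D}_1\cup\mathcal{D}_2$ with $\mathcal{D}_1\cap\mathcal{D}_2=\varnothing$ such that $\big(\bigcup_{i\in\mathcal{D}_1}\varphi_i(F)\big)\cap\big(\bigcup_{i\in\mathcal{D}_2}\varphi_i(F)\big)$ is a singleton; otherwise it is non-fragile. *)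

(* Defs.v *)
From HB Require Import structures.
From mathcomp Require Import all_boot all_order all_algebra.
From mathcomp Require Import all_classical all_reals all_analysis.
Set Implicit Arguments.
Unset Strict Implicit.
Unset Printing Implicit Defensive.
Import Order.TTheory GRing.Theory Num.Theory.
Import numFieldNormedType.Exports.
Local Open Scope classical_set_scope.
Local Open Scope ring_scope.

Definition phi (R : realType) (N : nat) (i : 'I_N * 'I_N) (x : R * R) : R * R :=
  ((x.1 + (i.1 : nat)%:R) / N%:R, (x.2 + (i.2 : nat)%:R) / N%:R).

Definition cells (R : realType) (N : nat) (E : {set 'I_N * 'I_N})
    (F : set (R * R)) : set (R * R) :=
  \bigcup_(i in [set` E]) (phi i @` F).

(* By Hutchinson's theorem exactly one set F satisfies this when E is nonempty
   and N >= 2, so the predicate pins down the carpet F(N, E). *)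
Definition is_GSC (R : realType) (N : nat) (E : {set 'I_N * 'I_N})
    (F : set (R * R)) : Prop :=
  [/\ F !=set0, compact F & F = cells E F].

Definition fragile (R : realType) (N : nat) (D : {set 'I_N * 'I_N})
    (F : set (R * R)) : Prop :=
  exists D1 D2 : {set 'I_N * 'I_N},
    [/\ D = D1 :|: D2, D1 :&: D2 = finset.set0
      & exists x : R * R, cells D1 F `&` cells D2 F = [set x]].

(* [connected B] is connectedness of B in its subspace topology, so this is the
   set of cut points of the space A, for A connected. *)
Definition cut_points (T : topologicalType) (A : set T) : set T :=
  [set x | A x /\ ~ connected (A `\ x)].

(* Main.v *)
(* Write [a ~ b] in [F \ x] when a continuum of [F] avoiding [x] contains both
   points; small cells are continua, so the classes are open and closed in
   [F \ x], and [x] is a cut point when there are at least two.  Suppose that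
   there are finitely many cut points.

   If no cell through [x] had a cut point over [x], each cell minus [x] would lie
   in one class and the carpet would be fragile; so every cut point is the image
   of a cut point in some cell.  By finiteness some cut point [x] is periodic, and
   after passing to a power of the digit set it is fixed by one cell map [c].

   For [z] cut and a cell extreme in a generic direction, the images of [z] under
   the powers of the cell map are eventually not cut points, so every class of
   [F \ z] has to touch neighbouring cells on the opposite side; if [z] is fixed
   by the cell, the classes joined to other cells still do.  Hence these classes
   span the unit square horizontally or vertically, and by planarity they all do
   so in the same direction, say horizontally.  For the fixed point
   [x] the lower and upper of two such classes contain all of the bottom and the
   top of [F], and the cell of [x] has no left or right neighbour.  If [y] is
   another cut point, a class of [F \ y] spans between them and cuts off the
   bottom (or the top), so [c y] separates the upper from the lower neighbours of
   the cell and is a cut point again.  Applied to all large powers of [c], this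
   yields infinitely many cut points [c^n y]. *)

Require Import Defs.
From HB Require Import structures.
From mathcomp Require Import all_boot all_order all_algebra.
From mathcomp Require Import all_classical all_reals all_analysis.
From mathcomp Require Import lra ring zify.
Set Implicit Arguments.
Unset Strict Implicit.
Unset Printing Implicit Defensive.
Import Order.TTheory GRing.Theory Num.Theory.
Import numFieldNormedType.Exports.
Local Open Scope classical_set_scope.
Local Open Scope ring_scope.

(** Inside [P] the set [A] is closed, and also open as the complement of [B]. Connectedness is
    mostly used in this form below. *)
Lemma connected_split (T : topologicalType) (P A B : set T) p :
  connected P -> closed A -> closed B -> P `<=` A `|` B ->
  (forall z, P z -> A z -> ~ B z) -> P p -> A p -> P `<=` A.
Proof.
move=> cP cA cB PAB dis Pp Ap z Pz.
have E : P `&` A = P.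
  apply: cP; first by exists p.
    exists (~` B); first exact: closed_openC.
    apply/seteqP; split=> w [Pw h]; split=> //; first exact: dis.
    by have [] := PAB _ Pw.
  by exists A.
by rewrite -E in Pz; case: Pz.
Qed.

(** * Connected sets crossing a rectangle *)

Section Crossing.
Context {R : realType}.
Implicit Types (x y z p q : R * R) (P Q A B : set (R * R)).

Lemma closed_of_approx A :
  (forall z, (forall e, 0 < e -> exists2 a, A a & `|z - a| < e) -> A z) ->
  closed A.
Proof.
move=> h z cz; apply: h => e e0.
have [a [Aa]] := cz _ (nbhsx_ballx z e e0).
by rewrite -ball_normE /= => hb; exists a.
Qed.

Lemma approx_of_closed A z : closed A ->
  (forall e, 0 < e -> exists2 a, A a & `|z - a| < e) -> A z.
Proof.
move=> cA h; apply: cA => U /nbhs_ballP[e /= e0 hU].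
have [a Aa ha] := h _ e0; exists a; split=> //; apply: hU.
by rewrite -ball_normE.
Qed.

Lemma closed_gap A z : closed A -> ~ A z ->
  exists2 e, 0 < e & forall a, A a -> e <= `|z - a|.
Proof.
move=> cA nAz; apply: contrapT => h; apply: nAz.
apply: approx_of_closed => // e e0; apply: contrapT => h'; apply: h.
exists e => // a Aa; rewrite leNgt; apply/negP => hlt; apply: h'.
by exists a.
Qed.

Lemma compact_closed_plane A : compact A -> closed A.
Proof. by apply: compact_closed; exact: norm_hausdorff. Qed.

Lemma continuous_fst_sub_snd :
  continuous (fun w : (R * R) * (R * R) => `|w.1 - w.2| : R).
Proof.
move=> w; apply: cvg_norm; apply: cvgB; [exact: cvg_fst|exact: cvg_snd].
Qed.

Lemma compact_separation P Q : compact P -> compact Q ->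
  (forall z, P z -> ~ Q z) ->
  exists2 d, 0 < d & forall p q, P p -> Q q -> d <= `|p - q|.
Proof.
move=> cP cQ dis.
have [[[p0 q0] /= [P0 Q0]]|no] := pselect (exists w, (P `*` Q) w); last first.
  by exists 1 => // p q Pp Qq; case: no; exists (p, q).
have [||c cPQ hc] := compact_EVT_min (A := P `*` Q)
    (f := fun w => `|w.1 - w.2|) _ (compact_setX cP cQ).
- by exists (p0, q0).
- by apply: continuous_subspaceT; exact: continuous_fst_sub_snd.
move: cPQ; rewrite inE => -[/= Pc Qc].
exists `|c.1 - c.2|.
  rewrite normr_gt0 subr_eq0; apply/eqP => E.
  by apply: (dis _ Pc); rewrite E.
by move=> p q Pp Qq; apply: (hc (p, q)); rewrite inE.
Qed.

Lemma ltr_norm_pair z (e : R) :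
  (`|z| < e) = (`|z.1| < e) && (`|z.2| < e).
Proof. by rewrite prod_normE gt_max. Qed.

Definition chain P (e : R) a b := exists (p : nat -> R * R) (n : nat),
  [/\ p 0%N = a, p n = b, forall k, (k <= n)%N -> P (p k)
    & forall k, (k < n)%N -> `|p k - p k.+1| < e].

(** Both the reachable and the unreachable points are traces on [P] of unions of balls of radius
    [e], so reachability is clopen in [P]. *)
Lemma connected_chain P e a b : connected P -> 0 < e -> P a -> P b ->
  chain P e a b.
Proof.
move=> cP e0 Pa Pb.
have chain_step c d : chain P e a c -> P d -> `|c - d| < e -> chain P e a d.
  move=> [p [n [p0 pn Pp st]]] Pd cd.
  exists (fun k => if (k <= n)%N then p k else d), n.+1; split.
  - by rewrite leq0n.
  - by rewrite ltnn.
  - by move=> k _; case: ifP => // ?; exact: Pp.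
  - move=> k; rewrite ltnS => kn; have [kn'|/eqP kn'] := boolP (k == n).
      by rewrite (eqP kn') leqnn ltnn pn.
    have {kn kn'}kn : (k < n)%N by lia.
    by rewrite (ltnW kn) kn; exact: st.
have E : P `&` [set c | chain P e a c] = P.
  apply: cP.
  - exists a; split=> //; exists (fun=> a), 0%N; split=> //.
  - exists (\bigcup_(c in P `&` [set c | chain P e a c]) ball c e).
      apply: bigcup_open => c _; exact: ball_open.
    apply/seteqP; split=> z [Pz h]; split=> //.
      by exists z => //; exact: ballxx.
    case: h => c [Pc hc]; rewrite -ball_normE /= => ?; exact: (chain_step c).
  - exists (~` \bigcup_(c in P `&` [set c | ~ chain P e a c]) ball c e).
      by apply: open_closedC; apply: bigcup_open => c _; exact: ball_open.
    apply/seteqP; split=> z [Pz h]; split=> //.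
      move=> [c [Pc hc]]; rewrite -ball_normE /= => ?; apply: hc.
      by apply: (chain_step z) => //; rewrite distrC.
    apply: contrapT => h'; apply: h; exists z => //; exact: ballxx.
by rewrite -E in Pb; case: Pb.
Qed.

(* Signed number of crossings of the ray {.1 > 0, .2 = 0} by the step u -> v. *)
Definition ray_crossing (u v : R * R) : int :=
  if (0 < u.1) && (0 < v.1) then (0 <= v.2)%R%:Z - (0 <= u.2)%R%:Z else 0.

Lemma ray_crossing_right u v : 0 < u.1 -> 0 < v.1 ->
  ray_crossing u v = (0 <= v.2)%R%:Z - (0 <= u.2)%R%:Z.
Proof. by rewrite /ray_crossing => -> ->. Qed.

Lemma ray_crossing_left u v : u.1 <= 0 -> ray_crossing u v = 0.
Proof. by move=> u0; rewrite /ray_crossing ltNge u0. Qed.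

Lemma ray_crossing_half u v : (0 <= u.2) = (0 <= v.2) -> ray_crossing u v = 0.
Proof. by rewrite /ray_crossing => ->; rewrite subrr; case: ifP. Qed.

(** If both abscissas are positive, closeness to [w] forces [u.1 < d]. In the sup norm [u.2] then
    has size at least [d], and a step shorter than [d] cannot change its sign. *)
Lemma ray_crossing_far u v w (d : R) : w.1 <= 0 -> d <= `|u| ->
  `|u - v| < d -> `|u - w| < d -> ray_crossing u v = 0.
Proof.
move=> w0 du; rewrite !ltr_norm_pair /= => /andP[_ uv] /andP[uw _].
rewrite /ray_crossing; case: ifPn => // /andP[u0 v0].
move: du; rewrite prod_normE le_max => /orP[du|du].
  by move: uw du; rewrite (gtr0_norm u0) ltr_norml => /andP[_ ?] ?; exfalso; lra.
have [u2|u2] := leP 0 u.2.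
  have -> : 0 <= v.2.
    move: uv du; rewrite (ger0_norm u2) ltr_norml => /andP[? ?] ?. lra.
  by rewrite subrr.
have -> : (0 <= v.2) = false.
  apply/negbTE; rewrite -ltNge.
  by move: uv du; rewrite (ltr0_norm u2) ltr_norml => /andP[? ?] ?; lra.
by rewrite subrr.
Qed.

(** Local invariance of the winding number. If all four abscissas are positive, both sides
    telescope; otherwise [ray_crossing_far] makes every term vanish. *)
Lemma ray_crossing_square (u v w t : R * R) (d : R) :
  (forall a b, a \in [:: u; v; w; t] -> b \in [:: u; v; w; t] ->
     d <= `|a| /\ `|a - b| < d) ->
  ray_crossing u v + ray_crossing v w = ray_crossing u t + ray_crossing t w.
Proof.
move=> h.
have [] := boolP (all (fun a => 0 < a.1) [:: u; v; w; t]).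
  move=> /and5P[u0 v0 w0 t0 _]; rewrite !ray_crossing_right //; lia.
move=> /allPn[z zin]; rewrite -leNgt => z0.
have far a b : a \in [:: u; v; w; t] -> b \in [:: u; v; w; t] ->
    ray_crossing a b = 0.
  move=> ain bin; have [da ab] := h _ _ ain bin; have [_ az] := h _ _ ain zin.
  exact: (ray_crossing_far z0 da ab az).
by rewrite !far // !inE eqxx ?orbT.
Qed.

(* Two connected sets crossing a rectangle in transverse directions meet: the
   vectors p_k - q_l along fine chains avoid 0, so their winding number around
   the rectangle of indices vanishes, but the boundary data make it -1. *)
Lemma crossing P Q p0 p1 q0 q1 : compact P -> connected P ->
  compact Q -> connected Q -> (forall z, P z -> ~ Q z) ->
  P p0 -> P p1 -> Q q0 -> Q q1 ->
  (forall q, Q q -> p0.1 < q.1 < p1.1) ->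
  (forall p, P p -> q0.2 < p.2 < q1.2) -> False.
Proof.
move=> cP nP cQ nQ dis Pp0 Pp1 Qq0 Qq1 hQ hP.
have [d d0 hd] := compact_separation cP cQ dis.
(* The corners of an index square differ by at most one step of each chain, hence by less than
   [d]. *)
have e0 : 0 < d / 2 by lra.
have [p [r [pz pr Pp sp]]] := connected_chain nP e0 Pp0 Pp1.
have [q [s [qz qs Qq sq]]] := connected_chain nQ e0 Qq0 Qq1.
pose w k l := p k - q l.
pose h k l := ray_crossing (w k l) (w k.+1 l).
pose v k l := ray_crossing (w k l) (w k l.+1).
have square k l : (k < r)%N -> (l < s)%N -> h k l + v k.+1 l = v k l + h k l.+1.
  move=> kr ls; apply: (@ray_crossing_square _ _ _ _ d) => a b.
  have key i j i' j' : (i <= r)%N -> (j <= s)%N -> `|p i - p i'| < d / 2 ->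
      `|q j - q j'| < d / 2 -> d <= `|w i j| /\ `|w i j - w i' j'| < d.
    move=> ir js pp qq; split; first by apply: hd; [exact: Pp|exact: Qq].
    rewrite /w; have -> : p i - q j - (p i' - q j') = (p i - p i') - (q j - q j').
      by rewrite !opprB addrACA [RHS]addrACA; congr (_ + _); rewrite addrC.
    apply: le_lt_trans (ler_normB _ _) _; lra.
  have pk := sp _ kr; have ql := sq _ ls.
  have pk' : `|p k.+1 - p k| < d / 2 by rewrite distrC.
  have ql' : `|q l.+1 - q l| < d / 2 by rewrite distrC.
  by rewrite !inE => /or4P[] /eqP-> /or4P[] /eqP->; apply: key;
    rewrite ?subrr ?normr0 // ltnW.
have colsum k : (k < r)%N ->
    \sum_(0 <= l < s) v k.+1 l = \sum_(0 <= l < s) v k l.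
  move=> kr.
  (* [q0] lies below [P], so all [p k - q0] have positive ordinate; in the same way all [p k - q1]
     have negative ordinate. *)
  have h0 : h k 0%N = 0.
    apply: ray_crossing_half; rewrite /w /= qz.
    have /andP[? _] := hP _ (Pp k (ltnW kr)); have /andP[? _] := hP _ (Pp _ kr).
    by rewrite !subr_ge0 !ltW.
  have hs : h k s = 0.
    apply: ray_crossing_half; rewrite /w /= qs.
    have /andP[_ h1] := hP _ (Pp k (ltnW kr)); have /andP[_ h2] := hP _ (Pp _ kr).
    by rewrite !subr_ge0 !leNgt h1 h2.
  transitivity (\sum_(0 <= l < s) (v k l + (h k l.+1 - h k l))).
    apply: eq_big_nat => l /andP[_ ls]; have := square k l kr ls; lia.
  by rewrite big_split /= telescope_sumr // h0 hs subrr addr0.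
have sums k : (k <= r)%N ->
    \sum_(0 <= l < s) v k l = \sum_(0 <= l < s) v 0%N l.
  by elim: k => // k ih kr; rewrite colsum // ih // ltnW.
(* [p0] lies to the left of [Q], so the first column stays away from the ray. *)
have v0 : \sum_(0 <= l < s) v 0%N l = 0.
  rewrite big_nat big1 // => l /andP[_ ls]; apply: ray_crossing_left.
  by rewrite /w /= pz subr_le0 ltW //; have /andP[] := hQ _ (Qq _ (ltnW ls)).
(* [p1] lies to the right of [Q], so every step counts and the sum telescopes from indicator 1 at
   [q0] to indicator 0 at [q1]. *)
have : \sum_(0 <= l < s) v r l = - 1.
  transitivity (\sum_(0 <= l < s) ((0 <= (w r l.+1).2)%R%:Z - (0 <= (w r l).2)%R%:Z)).
    apply: eq_big_nat => l /andP[_ ls]; apply: ray_crossing_right.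
      by rewrite /w /= pr subr_gt0; have /andP[] := hQ _ (Qq _ (ltnW ls)).
    by rewrite /w /= pr subr_gt0; have /andP[] := hQ _ (Qq _ ls).
  rewrite telescope_sumr // /w /= qz qs pr !subr_ge0.
  have /andP[h1 h2] := hP _ Pp1.
  by rewrite leNgt h2 /= (ltW h1).
by rewrite sums // v0.
Qed.

End Crossing.

(** * Continua spanning the unit square *)

Section UnitSquare.
Context {R : realType}.
Implicit Types (x y z p q : R * R) (P Q A B : set (R * R)).

Definition unit_square : set (R * R) := [set z | 0 <= z.1 <= 1 /\ 0 <= z.2 <= 1].

Definition reflect_y (z : R * R) : R * R := (z.1, 1 - z.2).
Definition transpose (z : R * R) : R * R := (z.2, z.1).

Lemma reflect_yK : involutive reflect_y.
Proof. by move=> [a b]; rewrite /reflect_y /= subKr. Qed.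

Lemma transposeK : involutive transpose.
Proof. by move=> []. Qed.

Lemma continuous_plane (T : topologicalType) (f g : T -> R) :
  continuous f -> continuous g -> continuous (fun t => (f t, g t) : R * R).
Proof. move=> cf cg t.
by apply: (cvg_pair (G := nbhs (f t)) (H := nbhs (g t))); [exact: cf|exact: cg]. Qed.

Lemma continuous_coord1 : continuous (fun z : R * R => z.1).
Proof. by move=> z; exact: cvg_fst. Qed.

Lemma continuous_coord2 : continuous (fun z : R * R => z.2).
Proof. by move=> z; exact: cvg_snd. Qed.

Lemma continuous_reflect_y : continuous reflect_y.
Proof.
apply: continuous_plane; first exact: continuous_coord1.
by move=> z; apply: cvgB; [exact: cvg_cst|exact: continuous_coord2].
Qed.

Lemma continuous_transpose : continuous transpose.
Proof.
by apply: continuous_plane; [exact: continuous_coord2|exact: continuous_coord1].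
Qed.

Lemma compact_image (f : R * R -> R * R) P : continuous f -> compact P ->
  compact (f @` P).
Proof. by move=> cf; apply: continuous_compact; exact: continuous_subspaceT. Qed.

Lemma connected_image (f : R * R -> R * R) P : continuous f -> connected P ->
  connected (f @` P).
Proof.
move=> cf cP; apply: connected_continuous_connected => //.
exact: continuous_subspaceT.
Qed.

Lemma continuum_hseg (a b t : R) :
  let A := [set z : R * R | a <= z.1 <= b /\ z.2 = t] in
  compact A /\ connected A.
Proof.
move=> A; have -> : A = (fun s : R => (s, t)) @` `[a, b].
  apply/seteqP; split=> [[s y] [/= sab yt]|_ [s + <-]].
    by exists s; rewrite /= ?in_itv ?yt.
  by rewrite /= in_itv.
have cf : {within `[a, b], continuous (fun s : R => (s, t))}.
  apply: continuous_subspaceT; apply: continuous_plane; first by move=> s; exact: cvg_id.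
  by move=> s; exact: cvg_cst.
split; first by apply: continuous_compact => //; exact: segment_compact.
by apply: connected_continuous_connected => //; exact: segment_connected.
Qed.

Lemma continuum_vseg (a b t : R) :
  let A := [set z : R * R | a <= z.2 <= b /\ z.1 = t] in
  compact A /\ connected A.
Proof.
move=> A; have [c1 c2] := continuum_hseg a b t.
have -> : A = transpose @` [set z : R * R | a <= z.1 <= b /\ z.2 = t].
  apply/seteqP; split=> [[x y] /= h|_ [[x y] h <-]] //.
  by exists (y, x).
split; [apply: compact_image|apply: connected_image] => //;
  exact: continuous_transpose.
Qed.

Lemma continuumU A B z : A z -> B z -> compact A /\ connected A ->
  compact B /\ connected B -> compact (A `|` B) /\ connected (A `|` B).
Proof.
move=> Az Bz [cA nA] [cB nB]; split; first exact: compactU.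
by apply: connectedU => //; exists z.
Qed.

(** For boundary points of the square: [s] and [t] are the heights at which a spanning continuum
    meets the left and the right side. *)
Definition above (s t : R) (u : R * R) :=
  [\/ u.2 = 1, u.1 = 0 /\ s < u.2 | u.1 = 1 /\ t < u.2].

Definition below (s t : R) (u : R * R) :=
  [\/ u.2 = 0, u.1 = 0 /\ u.2 < s | u.1 = 1 /\ u.2 < t].

(** From the top side the arm goes straight up; from a vertical side it first moves outwards by 1/2.
    The last two clauses keep it off the horizontal prolongations of a continuum through [(0, s)]
    and [(1, t)]. *)
Lemma rising_arm (s t : R) u : 0 <= s <= 1 -> 0 <= t <= 1 ->
  unit_square u -> u <> (0, s) -> u <> (1, t) -> above s t u ->
  exists A q, [/\ compact A /\ connected A, A u, A q, q.2 = 2 &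
    forall z, A z -> [/\ -1 < z.1 < 2, unit_square z -> z = u,
      z.1 <= 0 -> z.2 <> s & 1 <= z.1 -> z.2 <> t]].
Proof.
case: u => u1 u2 /andP[s0 s1] /andP[t0 t1] [/= /andP[u10 u11] /andP[u20 u21]].
move=> us ut [/= E|/= [E su]|/= [E tu]].
- exists [set z | 1 <= z.2 <= 2 /\ z.1 = u1], (u1, 2); split.
  + exact: continuum_vseg.
  + by rewrite /= E; split=> //; lra.
  + by rewrite /=; split=> //; lra.
  + by [].
  move=> [z1 z2] /= [/andP[z21 z22] ->]; split; first by lra.
  + by move=> [_ /= /andP[_ ?]]; congr pair; lra.
  + move=> u1' zs; apply: us; congr pair; lra.
  + move=> u1' zs; apply: ut; congr pair; lra.
- exists ([set z | - (1/2) <= z.1 <= 0 /\ z.2 = u2] `|`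
          [set z | u2 <= z.2 <= 2 /\ z.1 = - (1/2)]), (- (1/2), 2); split.
  + apply: (@continuumU _ _ (- (1/2), u2)); [| |exact: continuum_hseg|exact: continuum_vseg];
    rewrite /=; split=> //; lra.
  + by left; split=> //=; lra.
  + by right; split=> //=; lra.
  + by [].
  move=> [z1 z2] /= [] [/andP[? ?] E']; rewrite E'; split;
    try (by move=> ? ?; lra); try (by move=> [/= /andP[? ?] _]; exfalso; lra).
  + lra.
  + by move=> [/= /andP[? ?] _]; congr pair; lra.
  + lra.
- exists ([set z | 1 <= z.1 <= 3/2 /\ z.2 = u2] `|`
          [set z | u2 <= z.2 <= 2 /\ z.1 = 3/2]), (3/2, 2); split.
  + apply: (@continuumU _ _ (3/2, u2)); [| |exact: continuum_hseg|exact: continuum_vseg];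
    rewrite /=; split=> //; lra.
  + by left; split=> //=; lra.
  + by right; split=> //=; lra.
  + by [].
  move=> [z1 z2] /= [] [/andP[? ?] E']; rewrite E'; split;
    try (by move=> ? ?; lra); try (by move=> [/= /andP[? ?] _]; exfalso; lra).
  + lra.
  + by move=> [/= /andP[? ?] _]; congr pair; lra.
  + lra.
Qed.

Lemma falling_arm (s t : R) u : 0 <= s <= 1 -> 0 <= t <= 1 ->
  unit_square u -> u <> (0, s) -> u <> (1, t) -> below s t u ->
  exists A q, [/\ compact A /\ connected A, A u, A q, q.2 = - 1 &
    forall z, A z -> [/\ -1 < z.1 < 2, unit_square z -> z = u,
      z.1 <= 0 -> z.2 <> s & 1 <= z.1 -> z.2 <> t]].
Proof.
case: u => u1 u2 hs ht [/= hu1 hu2] us ut hu.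
have [||||||A [q [[cA nA] Au Aq q2 hA]]] := @rising_arm (1 - s) (1 - t) (u1, 1 - u2).
- by lra.
- by lra.
- by split=> //=; lra.
- by move=> [e1 e2]; apply: us; rewrite e1; congr pair; lra.
- by move=> [e1 e2]; apply: ut; rewrite e1; congr pair; lra.
- case: hu => /= [e|[e1 e2]|[e1 e2]]; [apply: Or31|apply: Or32|apply: Or33];
    rewrite /=; do ?split => //; lra.
exists (reflect_y @` A), (reflect_y q); split.
- by split; [apply: compact_image|apply: connected_image] => //;
    exact: continuous_reflect_y.
- by exists (u1, 1 - u2) => //; rewrite /reflect_y /= subKr.
- by exists q.
- by rewrite /= q2; lra.
move=> _ [z Az <-]; have [h1 h2 h3 h4] := hA _ Az; rewrite /reflect_y /=; split=> //.
- move=> [/= ? ?]; rewrite h2 /= ?subKr //; split=> //=; lra.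
- by move=> /h3 h ?; apply: h; lra.
- by move=> /h4 h ?; apply: h; lra.
Qed.

(* Disjoint arms attached outside the square turn positions on the boundary into
   the situation of [crossing]. *)
Lemma spanning_separates P Q (s t : R) u v : compact P -> connected P ->
  compact Q -> connected Q -> (forall z, P z -> ~ Q z) ->
  P `<=` unit_square -> Q `<=` unit_square ->
  P (0, s) -> P (1, t) -> Q u -> Q v -> above s t u -> below s t v -> False.
Proof.
move=> cP nP cQ nQ dis Psq Qsq P0 P1 Qu Qv hu hv.
have [/= _ hs] := Psq _ P0; have [/= _ ht] := Psq _ P1.
have nPz w z : Q w -> P z -> w <> z by move=> Qw /dis + E; rewrite -E.
have [A [q1 [nA Au Aq1 q12 hA]]] :=
  rising_arm hs ht (Qsq _ Qu) (nPz _ _ Qu P0) (nPz _ _ Qu P1) hu.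
have [B [q0 [nB Bv Bq0 q02 hB]]] :=
  falling_arm hs ht (Qsq _ Qv) (nPz _ _ Qv P0) (nPz _ _ Qv P1) hv.
(* [L] and [T] prolong [P] to the abscissas -1 and 2, beyond the strip that contains the arms. *)
pose L := [set z : R * R | - 1 <= z.1 <= 0 /\ z.2 = s].
pose T := [set z : R * R | 1 <= z.1 <= 2 /\ z.2 = t].
have [cP' nP'] : compact (P `|` L `|` T) /\ connected (P `|` L `|` T).
  apply: (@continuumU _ _ (1, t)); first by left.
  - by split=> //=; lra.
  - apply: (@continuumU _ _ (0, s)) => //; first by split=> //=; lra.
    exact: continuum_hseg.
  exact: continuum_hseg.
have [cQ' nQ'] : compact (Q `|` A `|` B) /\ connected (Q `|` A `|` B).
  apply: (@continuumU _ _ v) => //; first by left.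
  exact: (@continuumU _ _ u).
apply: (crossing (P := P `|` L `|` T) (Q := Q `|` A `|` B)
  (p0 := (- 1, s)) (p1 := (2, t)) (q0 := q0) (q1 := q1)) => //.
- have arm C w z : Q w -> (forall z, C z -> [/\ -1 < z.1 < 2,
      unit_square z -> z = w, z.1 <= 0 -> z.2 <> s & 1 <= z.1 -> z.2 <> t]) ->
      C z -> ~ (P `|` L `|` T) z.
    move=> Qw hC /hC[h1 h2 h3 h4] [[Pz|[/= /andP[_ ?] ?]]|[/= /andP[? _] ?]].
    + by apply: (nPz w z) => //; rewrite h2 //; exact: Psq.
    + exact: h3.
    + exact: h4.
  move=> z Pz [[Qz|Az]|Bz]; last by apply: (arm B v z).
    case: Pz => [[Pz|[/= /andP[_ h1] h2]]|[/= /andP[h1 _] h2]].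
    + exact: dis Pz Qz.
    + have [/= /andP[h _] _] := Qsq _ Qz; apply: (nPz z (0, s)) => //.
      by case: (z) h1 h2 h => ? ? /= ? -> ?; congr pair; lra.
    + have [/= /andP[_ h] _] := Qsq _ Qz; apply: (nPz z (1, t)) => //.
      by case: (z) h1 h2 h => ? ? /= ? -> ?; congr pair; lra.
  by apply: (arm A u z).
- by left; right; split=> //=; lra.
- by right; split=> //=; lra.
- by right.
- by left; right.
- move=> q [[/Qsq[/= ? _]|/hA[]//]|/hB[]//]; lra.
- rewrite q02 q12 => p [[/Psq[/= _ ?]|[/= _ ?]]|[/= _ ?]]; lra.
Qed.

End UnitSquare.

(** * Self-similar sets and the classes of their punctured spaces *)

Section Cells.
Context {R : realType}.
Implicit Types (a b x y z : R * R) (p q i j : nat * nat) (A B P Q F : set (R * R)).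

Definition cell (M : nat) (p : nat * nat) (z : R * R) : R * R :=
  ((z.1 + p.1%:R) / M%:R, (z.2 + p.2%:R) / M%:R).

(** Digits are listed as pairs of naturals, so that the same [F] can be tiled at every level by
    words, and reflected sets by reflected digits. *)
Record tiling (M : nat) (E : seq (nat * nat)) (F : set (R * R)) : Prop := Tiling {
  tiling_gt0 : (0 < M)%N;
  tiling_lt : forall p, p \in E -> (p.1 < M)%N /\ (p.2 < M)%N;
  tilingE : forall z, F z <-> exists p f, [/\ p \in E, F f & z = cell M p f];
  tiling_compact : compact F;
  tiling_connected : connected F;
  tiling_square : F `<=` unit_square }.

(** Joining by continua, not by arbitrary connected sets, supplies the compactness that [crossing]
    needs. *)
Definition joined A a b :=
  exists Q, [/\ compact Q, connected Q, Q `<=` A, Q a & Q b].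

Lemma joined_sym A a b : joined A a b -> joined A b a.
Proof. by move=> [Q [? ? ? ? ?]]; exists Q. Qed.

Lemma joined_trans A b a c : joined A a b -> joined A b c -> joined A a c.
Proof.
move=> [P [cP nP PA Pa Pb]] [Q [cQ nQ QA Qb Qc]]; exists (P `|` Q).
have [? ?] := continuumU Pb Qb (conj cP nP) (conj cQ nQ).
by split=> //; [move=> z [/PA|/QA]|left|right].
Qed.

Lemma joined_sub A B a b : A `<=` B -> joined A a b -> joined B a b.
Proof. by move=> AB [Q [? ? QA ? ?]]; exists Q; split=> // z /QA /AB. Qed.

Lemma joined_refl A a : A a -> joined A a a.
Proof.
move=> Aa; exists [set a]; split=> //; first exact: compact_set1.
  exact: connected1.
by move=> z ->.
Qed.

Lemma joined_mem A a b : joined A a b -> A a /\ A b.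
Proof. by move=> [Q [_ _ QA Qa Qb]]; split; exact: QA. Qed.

Lemma joined_image (f : R * R -> R * R) A B a b : continuous f ->
  (forall z, A z -> B (f z)) -> joined A a b -> joined B (f a) (f b).
Proof.
move=> cf fAB [Q [cQ nQ QA Qa Qb]]; exists (f @` Q); split.
- exact: compact_image.
- exact: connected_image.
- by move=> _ [z /QA /fAB ? <-].
- by exists a.
- by exists b.
Qed.

Section Cell.
Variables (M : nat) (M0 : (0 < M)%N).

Let Mr0 : (M%:R : R) != 0.
Proof. by rewrite pnatr_eq0 -lt0n. Qed.

Lemma cell_inj p : injective (cell M p).
Proof.
move=> [a b] [c d] [/(mulIf (invr_neq0 Mr0)) /addIr -> ].
by move=> /(mulIf (invr_neq0 Mr0)) /addIr ->.
Qed.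

Lemma continuous_cell p : continuous (cell M p).
Proof.
apply: continuous_plane => z; apply: cvgMl; apply: cvgD;
  try exact: cvg_cst; [exact: continuous_coord1|exact: continuous_coord2].
Qed.

Lemma cell_dist p z w : `|cell M p z - cell M p w| = `|z - w| / M%:R.
Proof.
rewrite !prod_normE /=.
have E (a b c : R) : (a + c) / M%:R - (b + c) / M%:R = (a - b) / M%:R.
  by field.
rewrite !E !normrM !normfV (ger0_norm (ler0n _ M)) maxr_pMl //.
Qed.

Lemma cell_eq p q z w : cell M p z = cell M q w ->
  z.1 + p.1%:R = w.1 + q.1%:R /\ z.2 + p.2%:R = w.2 + q.2%:R.
Proof.
by move=> [/(mulIf (invr_neq0 Mr0)) -> /(mulIf (invr_neq0 Mr0)) ->].
Qed.

Lemma cell_comp K p q z : (0 < K)%N ->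
  cell (M * K) (K * p.1 + q.1, K * p.2 + q.2)%N z = cell M p (cell K q z).
Proof.
move=> K0; rewrite /cell /= !natrM !natrD !natrM.
have Kr0 : (K%:R : R) != 0 by rewrite pnatr_eq0 -lt0n.
by congr pair; field; rewrite Mr0 Kr0.
Qed.

End Cell.

Lemma cell1 z : cell 1 (0, 0)%N z = z.
Proof. by case: z => a b; rewrite /cell /= !addr0 !divr1. Qed.

Lemma unit_square_dist z w : unit_square z -> unit_square w -> `|z - w| <= 1.
Proof.
move=> [/andP[? ?] /andP[? ?]] [/andP[? ?] /andP[? ?]].
by rewrite prod_normE ge_max /= !ler_norml; lra.
Qed.

Lemma expn_inv_lt (M : nat) (e : R) : (1 < M)%N -> 0 < e ->
  exists n, forall m, (n <= m)%N -> (M ^ m)%:R^-1 < e.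
Proof.
move=> M1 e0; exists (Num.bound e^-1) => m nm.
have h : e^-1 < (M ^ m)%:R.
  apply: lt_le_trans (archi_boundP _) _; first by rewrite invr_ge0 ltW.
  rewrite ler_nat; apply: leq_trans nm _; exact/ltnW/ltn_expl.
rewrite -[e]invrK ltf_pV2 ?posrE ?invr_gt0 //.
by apply: lt_trans h; rewrite invr_gt0.
Qed.

Definition cells_seq M (L : seq (nat * nat)) F : set (R * R) :=
  [set z | exists p f, [/\ p \in L, F f & z = cell M p f]].

Lemma compact_cells_seq M L F : (0 < M)%N -> compact F ->
  compact (cells_seq M L F).
Proof.
move=> M0 cF; elim: L => [|p L ih].
  have -> : cells_seq M [::] F = set0; last exact: compact0.
  by apply/seteqP; split=> // z [p [f []]].
have -> : cells_seq M (p :: L) F = cell M p @` F `|` cells_seq M L F.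
  apply/seteqP; split=> z.
    move=> [q [f [+ Ff ->]]]; rewrite inE => /orP[/eqP->|qL].
      by left; exists f.
    by right; exists q, f.
  move=> [[f Ff <-]|[q [f [qL Ff ->]]]].
    by exists p, f; rewrite inE eqxx.
  by exists q, f; rewrite inE qL orbT.
by apply: compactU => //; apply: compact_image => //; exact: continuous_cell.
Qed.

(** * Iterated digit sets *)

Section Words.
Variable (N : nat) (N0 : (0 < N)%N).

(* The position in the grid of mesh [N ^- n] of the cell with address
   [w 0, ..., w n.-1]. *)
Fixpoint word_pos (w : nat -> nat * nat) (n : nat) : nat * nat :=
  if n is m.+1 then
    let q := word_pos (fun k => w k.+1) m in
    (N ^ m * (w 0%N).1 + q.1, N ^ m * (w 0%N).2 + q.2)%N
  else (0, 0)%N.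

Lemma cell_word_posS w n z : cell (N ^ n.+1) (word_pos w n.+1) z =
  cell N (w 0%N) (cell (N ^ n) (word_pos (fun k => w k.+1) n) z).
Proof. by rewrite expnS /= cell_comp // expn_gt0 N0. Qed.

Lemma cell_word_pos (w : nat -> nat * nat) (x : nat -> R * R) n :
  (forall k, (k < n)%N -> x k = cell N (w k) (x k.+1)) ->
  x 0%N = cell (N ^ n) (word_pos w n) (x n).
Proof.
elim: n w x => [|n ih] w x h; first by rewrite expn0 /= cell1.
rewrite cell_word_posS h //; congr cell; apply: (ih _ (fun k => x k.+1)) => k kn.
exact: h.
Qed.

Variable E : seq (nat * nat).

Fixpoint words n : seq (nat * nat) :=
  if n is m.+1 then
    [seq (N ^ m * p.1 + q.1, N ^ m * p.2 + q.2)%N | p <- E, q <- words m]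
  else [:: (0, 0)%N].

Lemma word_pos_words w n : (forall k, (k < n)%N -> w k \in E) ->
  word_pos w n \in words n.
Proof.
elim: n w => //= n ih w h.
apply/allpairsP; exists (w 0%N, word_pos (fun k => w k.+1) n).
by split=> //; [exact: h|apply: ih => k kn; exact: h].
Qed.

(** Passing to words makes cells arbitrarily small, and turns a periodic point of the cell maps into
    a fixed point of a single one. *)
Lemma tiling_words (F : set (R * R)) n : tiling N E F -> tiling (N ^ n) (words n) F.
Proof.
move=> T; have [_ ltE FE cF nF sF] := T; elim: n => [|n [M0 lt_n FEn _ _ _]].
  split=> //=.
  - by move=> p; rewrite inE => /eqP->.
  - move=> z; split=> [Fz|[p [f []]]]; first by exists (0, 0)%N, z; rewrite cell1 inE.
    by rewrite inE => /eqP-> Ff ->; rewrite expn0 cell1.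
split=> //; first by rewrite expn_gt0 N0.
- move=> _ /allpairsP[[p q] [/ltE[/= p1 p2] /lt_n[/= q1 q2] ->]] /=.
  by rewrite expnSr; split; nia.
- move=> z; split.
    move=> /FE[p [f [pE /FEn[q [g [qE Fg ->]]] ->]]].
    exists (N ^ n * p.1 + q.1, N ^ n * p.2 + q.2)%N, g; split=> //.
      by apply/allpairsP; exists (p, q).
    by rewrite expnS cell_comp.
  move=> [_ [f [/allpairsP[[p q] [/= pE qE ->]] Ff ->]]].
  rewrite expnS cell_comp //; apply/FE; exists p, (cell (N ^ n) q f); split=> //.
  by apply/FEn; exists q, f.
Qed.

End Words.

End Cells.

Section Classes.
Context {R : realType}.
Implicit Types (a b x y z : R * R) (p q i j : nat * nat) (A B P Q F : set (R * R)).

(* The classes of [conn F x] serve as the components of [F `\ x]; that they are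
   open in [F] follows from the connectedness of small cells. *)
Definition conn F x := joined (F `\ x).

Definition cut F x :=
  F x /\ exists a b, [/\ (F `\ x) a, (F `\ x) b & ~ conn F x a b].

Definition rest M E i F := cells_seq M [seq p <- E | p != i] F.

Lemma restP M E i F z :
  rest M E i F z <-> exists j f, [/\ j \in E, j <> i, F f & z = cell M j f].
Proof.
split=> [] [j [f]].
  by rewrite mem_filter => -[/andP[/eqP ji jE] Ff ->]; exists j, f.
move=> [jE ji Ff ->]; exists j, f; split=> //.
by rewrite mem_filter jE andbT; apply/eqP.
Qed.

Section Tiling.
Variables (F : set (R * R)) (M : nat) (E : seq (nat * nat)).
Hypotheses (T : tiling M E F) (M1 : (1 < M)%N).

Let M0 : (0 < M)%N := tiling_gt0 T.

Lemma tiling_closed : closed F.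
Proof. exact: compact_closed_plane (tiling_compact T). Qed.

Lemma tiling_cell i f : i \in E -> F f -> F (cell M i f).
Proof. by move=> iE Ff; apply/(tilingE T); exists i, f. Qed.

Lemma closed_rest i : closed (rest M E i F).
Proof.
apply: compact_closed_plane; apply: compact_cells_seq => //.
exact: tiling_compact T.
Qed.

Lemma closed_cell i : closed (cell M i @` F).
Proof.
apply: compact_closed_plane; apply: compact_image (tiling_compact T).
exact: continuous_cell.
Qed.

Lemma tiling_cell_rest i : F `<=` cell M i @` F `|` rest M E i F.
Proof.
move=> z /(tilingE T)[p [f [pE Ff ->]]].
have [->|/eqP pi] := eqVneq p i; first by left; exists f.
by right; apply/restP; exists p, f.
Qed.

(** At a level where cells are smaller than [e], the cells missing [z] stay at some distance [d]
    from it. A point of [F] closer than [d] shares a cell with [z], and that cell is the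
    continuum. *)
Lemma small_continuum z (e : R) : F z -> 0 < e -> exists2 d, 0 < d &
  forall z', F z' -> `|z - z'| < d -> exists Q, [/\ compact Q, connected Q,
    Q `<=` F, Q z /\ Q z' & forall w, Q w -> `|z - w| < e].
Proof.
move=> Fz e0; have [n /(_ _ (leqnn n)) ne] := expn_inv_lt M1 e0.
have Tn := tiling_words M0 n T; set K := (M ^ n)%N in Tn ne.
pose L := [seq p <- words M E n | `[< ~ (cell K p @` F) z >]].
have [||d d0 hd] := @closed_gap _ (cells_seq K L F) z.
- apply: compact_closed_plane; apply: compact_cells_seq; [exact: tiling_gt0 Tn|exact: tiling_compact T].
- move=> [p [f []]]; rewrite mem_filter => /andP[/asboolP h _] Ff zf.
  by apply: h; exists f.
exists d => // z' Fz' zz'.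
have [p [f [pE Ff z'f]]] := (tilingE Tn z').1 Fz'.
have [g Fg zg] : (cell K p @` F) z.
  apply: contrapT => h; have : d <= `|z - z'|.
    by apply: hd; exists p, f; rewrite mem_filter pE andbT; split=> //; apply/asboolP.
  by rewrite leNgt zz'.
exists (cell K p @` F); split.
- apply: compact_image (tiling_compact T); exact: continuous_cell.
- apply: connected_image (tiling_connected T); exact: continuous_cell.
- by move=> _ [h Fh <-]; apply/(tilingE Tn); exists p, h.
- by split; [exists g|exists f].
- move=> _ [h Fh <-]; rewrite -zg cell_dist ?(tiling_gt0 Tn) //.
  apply: le_lt_trans ne; rewrite ler_piMl ?invr_ge0 ?ler0n //.
  by apply: unit_square_dist; exact: (tiling_square T).
Qed.

Lemma joined_near A z : closed (~` A) -> A z -> F z -> exists2 d, 0 < d &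
  forall z', F z' -> `|z - z'| < d -> joined (F `&` A) z z'.
Proof.
move=> cA Az Fz; have [|e e0 he] := closed_gap cA (z := z); first by apply.
have [d d0 hd] := small_continuum Fz e0; exists d => // z' Fz' zz'.
have [Q [cQ nQ QF [Qz Qz'] Qe]] := hd _ Fz' zz'; exists Q; split=> //.
move=> w Qw; split; first exact: QF.
by apply: contrapT => nAw; have := he _ nAw; rewrite leNgt Qe.
Qed.

Lemma conn_near x z : F z -> z <> x -> exists2 d, 0 < d &
  forall z', F z' -> `|z - z'| < d -> conn F x z z'.
Proof.
move=> Fz zx; have [||//|d d0 hd] := @joined_near (~` [set x]) z.
- by rewrite setCK; apply: compact_closed_plane; exact: compact_set1.
- by [].
exists d => // z' Fz' zz'; exact: hd.
Qed.


Lemma conn_sym x a b : conn F x a b -> conn F x b a.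
Proof. exact: joined_sym. Qed.

Lemma conn_trans x b a c : conn F x a b -> conn F x b c -> conn F x a c.
Proof. exact: joined_trans. Qed.

Lemma connP x a b : conn F x a b -> [/\ F a, a <> x, F b & b <> x].
Proof. by move=> h; have [[? ?] [? ?]] := joined_mem h; split. Qed.

Lemma conn_refl x a : F a -> a <> x -> conn F x a a.
Proof. by move=> Fa ax; apply: joined_refl. Qed.

(** A limit point other than [x] is joined to all nearby points of [F], hence to the class. The
    point [x] is added because the class accumulates there. *)
Lemma closed_class x a : F x -> closed (conn F x a `|` [set x]).
Proof.
move=> Fx; apply: closed_of_approx => z h.
have [->|/eqP zx] := eqVneq z x; [by right|left].
have Fz : F z.
  apply: (approx_of_closed tiling_closed) => e e0.
  by have [w [/connP[_ _ Fw _]|->] zw] := h _ e0; [exists w|exists x].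
have [d d0 hd] := conn_near Fz zx.
have zx0 : 0 < `|z - x| by rewrite normr_gt0 subr_eq0; apply/eqP.
have [|w cw zw] := h (Num.min d `|z - x|); first by rewrite lt_min d0.
move: zw; rewrite lt_min => /andP[zwd zwx].
case: cw => [cw|wx]; last by rewrite wx ltxx in zwx.
have [_ _ Fw _] := connP cw.
by apply: conn_trans cw _; apply: conn_sym; exact: hd.
Qed.

Lemma closed_class_compl x a : closed (F `&` ~` conn F x a).
Proof.
apply: closed_of_approx => z h; split.
  apply: (approx_of_closed tiling_closed) => e e0.
  by have [w [Fw _] zw] := h _ e0; exists w.
move=> az; have [_ _ Fz zx] := connP az; have [d d0 hd] := conn_near Fz zx.
have [w [Fw naw] zw] := h _ d0; apply: naw.
by apply: conn_trans az _; exact: hd.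
Qed.

(** Without a contact, the part in [B] of the class of [z] would be clopen in the connected set [F],
    yet it contains [z] and not [x]. *)
Lemma class_touches A B x z : closed A -> closed B -> F `<=` A `|` B ->
  F x -> A x -> ~ B x -> F z -> B z ->
  exists e, [/\ A e, B e & conn F x z e].
Proof.
move=> cA cB FAB Fx Ax nBx Fz Bz; apply: contrapT => no.
have zx : z <> x by move=> E'; apply: nBx; rewrite -E'.
suff [_] : (fun w => (conn F x z w \/ w = x) /\ B w) x by [].
apply: (connected_split (P := F) (A := (conn F x z `|` [set x]) `&` B)
  (B := A `|` (F `&` ~` conn F x z)) (p := z)) => //.
- exact: tiling_connected T.
- by apply: closedI => //; exact: closed_class.
- by apply: closedU => //; exact: closed_class_compl.
- move=> w Fw; have [Aw|Bw] := FAB _ Fw; first by right; left.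
  have [zw|zw] := pselect (conn F x z w); first by left; split=> //; left.
  by right; right.
- move=> w Fw [[zw|->//] Bw] [Aw|[_]//]; by apply: no; exists w.
- by split=> //; left; exact: conn_refl.
Qed.

(** [class_touches] is applied to the disc of radius [d / 2] around [x] and the complement of its
    interior; the contact then has distance exactly [d / 2]. *)
Lemma class_near_center x k (d : R) : F x -> F k -> k <> x -> 0 < d ->
  exists2 k', conn F x k k' & `|x - k'| < d.
Proof.
move=> Fx Fk kx d0.
have cd : continuous (fun w : R * R => `|x - w| : R).
  move=> w; apply: cvg_norm; apply: cvgB; [exact: cvg_cst|exact: cvg_id].
have [kd|kd] := ltP `|x - k| d; first by exists k => //; exact: conn_refl.
have cA : closed [set w | `|x - w| <= d / 2].
  by apply: preimage_closed (@closed_le _ _) => w _; exact: cd.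
have cB : closed [set w | d / 2 <= `|x - w|].
  by apply: preimage_closed (@closed_ge _ _) => w _; exact: cd.
have FAB : F `<=` [set w | `|x - w| <= d / 2] `|` [set w | d / 2 <= `|x - w|].
  by move=> w _ /=; have [?|?] := leP `|x - w| (d / 2); [left|right; exact: ltW].
have [|||e [/= h1 h2 h3]] := class_touches cA cB FAB Fx _ _ Fk.
- by rewrite /= subrr normr0; lra.
- by rewrite /= subrr normr0; lra.
- by rewrite /=; lra.
by exists e => //; lra.
Qed.

(** The class of [k] comes arbitrarily close to [x], and a small continuum avoiding [P] bridges the
    remaining gap. *)
Lemma join_to_center P x k : closed P -> ~ P x -> F x -> F k -> k <> x ->
  (forall w, P w -> ~ conn F x k w) -> joined (F `&` ~` P) x k.
Proof.
move=> cP nPx Fx Fk kx hP.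
have [|//|//|d d0 hd] := @joined_near (~` P) x; first by rewrite setCK.
have [k' kk' xk'] := class_near_center Fx Fk kx d0.
have [_ _ Fk' _] := connP kk'.
apply: joined_trans (hd _ Fk' xk') _.
case: kk' => Q [cQ nQ QF Qk Qk']; exists Q; split=> // w Qw.
split; first by have [] := QF _ Qw.
by move=> /hP; apply; exists Q.
Qed.

Lemma conn_switch x y k : F x -> F k -> k <> x -> y <> x -> ~ conn F x k y ->
  conn F y x k.
Proof.
move=> Fx Fk kx yx ky.
apply: joined_sub (_ : joined (F `&` ~` [set y]) x k) => //.
apply: join_to_center => //.
  by apply: compact_closed_plane; exact: compact_set1.
  by move=> /esym.
by move=> w ->.
Qed.

(** A relatively clopen subset of F \ x is a union of classes, and conversely each class is
    relatively clopen. *)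
Lemma cut_pointsP x : cut_points F x <-> cut F x.
Proof.
split=> [[Fx nc]|[Fx [a [b [Fa Fb nab]]]]]; split=> //.
  apply: contrapT => no; apply: nc => B [b Bb] [U oU BU] [C cC BC].
  have [Fb _] : ((F `\ x) `&` U) b by rewrite -BU.
  apply/seteqP; split=> z; first by rewrite BU => -[].
  move=> Fz; have [Q [_ nQ QF Qb Qz]] : conn F x b z.
    by apply: contrapT => nbz; apply: no; exists b, z.
  suff Cz : C z by rewrite BC.
  apply: (connected_split (P := Q) (A := C) (B := ~` U) (p := b)) Qz => //.
  - exact: open_closedC.
  - move=> q /QF Fq; have [Uq|?] := pselect (U q); [left|by right].
    have : B q by rewrite BU.
    by rewrite BC => -[].
  - move=> q /QF Fq Cq nUq; have : B q by rewrite BC.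
    by rewrite BU => -[].
  - by have [] : ((F `\ x) `&` C) b by rewrite -BC.
move=> nc.
have [//|bx] : (conn F x a `|` [set x]) b; last by case: Fb => _ /(_ bx).
apply: (connected_split (P := F `\ x) (B := F `&` ~` conn F x a) (p := a)) => //.
- exact: closed_class.
- exact: closed_class_compl.
- move=> z [Fz zx]; have [az|az] := pselect (conn F x a z); first by left; left.
  by right.
- by move=> z [Fz zx] [az [_]|] //.
- by left; case: Fa => ? ?; exact: conn_refl.
Qed.

Lemma conn_cell i x a b : i \in E -> conn F x a b ->
  conn F (cell M i x) (cell M i a) (cell M i b).
Proof.
move=> iE; apply: joined_image; first exact: continuous_cell.
move=> z [Fz zx]; split; first exact: tiling_cell.
by move=> /(cell_inj M0).
Qed.

(** A continuum avoiding the image of [x] joins the images of [a] and [b]. If the class of [a] had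
    no contact with other cells, its image would be clopen in that continuum and would have to
    contain the image of [b]. *)
Lemma not_cut_contact i x a b : ~ cut F (cell M i x) -> i \in E ->
  F x -> (F `\ x) a -> (F `\ x) b -> ~ conn F x a b ->
  exists2 e, conn F x a e & rest M E i F (cell M i e).
Proof.
move=> nc iE Fx [Fa ax] [Fb bx] nab; apply: contrapT => no; apply: nab.
have inj := @cell_inj R M M0 i.
have [Q [_ nQ QF Qa Qb]] : conn F (cell M i x) (cell M i a) (cell M i b).
  apply: contrapT => nab; apply: nc; split; first exact: tiling_cell.
  exists (cell M i a), (cell M i b); split=> //.
    by split; [exact: tiling_cell|move=> /inj].
  by split; [exact: tiling_cell|move=> /inj].
have [e [ae|ex] /inj eb] : (cell M i @` (conn F x a `|` [set x])) (cell M i b).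
- apply: (connected_split (P := Q) (p := cell M i a)
    (B := cell M i @` (F `&` ~` conn F x a) `|` rest M E i F)) Qb => //.
  + apply: compact_closed_plane; apply: compact_image.
      exact: continuous_cell.
    apply: (subclosed_compact (B := F)); [exact: closed_class|exact: tiling_compact T|].
    by move=> z [/connP[]|->].
  + apply: closedU; last exact: closed_rest.
    apply: compact_closed_plane; apply: compact_image.
      exact: continuous_cell.
    apply: (subclosed_compact (B := F)); [exact: closed_class_compl|exact: tiling_compact T|].
    by move=> z [].
  + move=> q /QF[/(@tiling_cell_rest i)[[f Ff <-] _|]]; last by right; right.
    have [af|af] := pselect (conn F x a f); first by left; exists f => //; left.
    by right; left; exists f.
  + move=> q /QF[_ qx] [e [ae|->] eq]; last by case: qx; rewrite -eq.
    move=> [[f [_ naf] fq]|re]; first by apply: naf;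
      rewrite -(inj _ _ (etrans eq (esym fq))).
    by apply: no; exists e => //; rewrite eq.
  + by exists a => //; left; exact: conn_refl.
- by rewrite -eb.
- by case: bx; rewrite -eb.
Qed.

(** If the digits differ in a coordinate, that coordinate of the fixed point is 0 or 1. Then the
    digit of [i] is 0 or [M - 1] respectively, and the digit of [j] would fall outside the grid. *)
Lemma fixed_cell_unique i j x z : i \in E -> j \in E -> F x -> F z ->
  cell M i x = x -> cell M j z = x -> i = j.
Proof.
move=> /(tiling_lt T)[i1 i2] /(tiling_lt T)[j1 j2] Fx Fz ix jz.
have [/andP[x10 x11] /andP[x20 x21]] := tiling_square T Fx.
have [/andP[z10 z11] /andP[z20 z21]] := tiling_square T Fz.
have Mr : (0 : R) < M%:R by rewrite ltr0n.
have key (s t : R) (k l : nat) : (k < M)%N -> (l < M)%N ->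
    0 <= s -> s <= 1 -> 0 <= t -> t <= 1 ->
    (s + k%:R) / M%:R = s -> (t + l%:R) / M%:R = s -> k = l.
  move=> kM lM s0 s1 t0 t1 ks ls.
  have {}ks : s + k%:R = s * M%:R by rewrite -[X in X * _]ks divfK // gt_eqF.
  have {}ls : t + l%:R = s * M%:R by rewrite -[X in X * _]ls divfK // gt_eqF.
  have kM' : (k.+1%:R : R) <= M%:R by rewrite ler_nat.
  have lM' : (l.+1%:R : R) <= M%:R by rewrite ler_nat.
  rewrite -!natr1 in kM' lM'.
  have [kl|lk|//] := ltngtP k l.
    have : (k.+1%:R : R) <= l%:R by rewrite ler_nat.
    rewrite -natr1 => ?.
    have Es : s = 1 by lra.
    rewrite Es mul1r in ks ls; have : (1 : R) <= 0 by lra.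
  by rewrite ler10.
  have : (l.+1%:R : R) <= k%:R by rewrite ler_nat.
  rewrite -natr1 => ?.
  have Es : s = 0 by lra.
  have : (0 : R) < k%:R by rewrite ltr0n; case: (k) lk.
  move=> ?.
  rewrite Es mul0r in ks; have : (1 : R) <= 0 by lra.
  by rewrite ler10.
have ix1 : (x.1 + i.1%:R) / M%:R = x.1 := congr1 fst ix.
have ix2 : (x.2 + i.2%:R) / M%:R = x.2 := congr1 snd ix.
have jz1 : (z.1 + j.1%:R) / M%:R = x.1 := congr1 fst jz.
have jz2 : (z.2 + j.2%:R) / M%:R = x.2 := congr1 snd jz.
rewrite (surjective_pairing i) (surjective_pairing j).
by rewrite (key x.1 z.1 i.1 j.1) // (key x.2 z.2 i.2 j.2).
Qed.

Lemma fixed_not_rest i x : i \in E -> F x -> cell M i x = x ->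
  ~ rest M E i F x.
Proof.
move=> iE Fx ix /restP[j [f [jE ji Ff xf]]]; apply: ji.
by apply/esym; apply: (fixed_cell_unique iE jE Fx Ff ix).
Qed.

Lemma fixed_contact i x a : i \in E -> F x -> cell M i x = x -> F a ->
  ~ (cell M i @` F) a ->
  exists a', [/\ F a', rest M E i F (cell M i a') & conn F x a (cell M i a')].
Proof.
move=> iE Fx ix Fa na.
have ra0 : rest M E i F a by have [] := tiling_cell_rest i Fa.
have [e [[a' Fa' <-] ra ca]] := class_touches (@closed_cell i) (@closed_rest i)
  (@tiling_cell_rest i) Fx (ex_intro2 _ _ x Fx ix) (fixed_not_rest iE Fx ix) Fa ra0.
by exists a'.
Qed.

End Tiling.

End Classes.

(** * Classes touch neighbouring cells *)

Section Ports.
Context {R : realType}.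
Implicit Types (a b x y z : R * R) (p q i j : nat * nat) (A B P Q F : set (R * R)).

Lemma finite_escape (T : Type) (A : set T) (f : nat -> T) m :
  finite_set A -> injective f -> exists2 n, (m <= n)%N & ~ A (f n).
Proof.
move=> fA inj; apply: contrapT => no; apply/infiniteP: fA.
pose g k := f (m + k)%N.
have gA : set_fun [set: nat] A g.
  by move=> k _; apply: contrapT => nA; apply: no; exists (m + k)%N; rewrite ?leq_addr.
have gi : set_inj [set: nat] g by move=> k l _ _ /inj /addnI.
have [h] : $|{injfun [set: nat] >-> A}| by apply/injfunPex; exists g.
exact: inj_card_le h.
Qed.

Lemma int_sign_cases (n : int) : -1 <= n <= 1 -> n = 0 \/ n = 1 \/ n = - 1.
Proof. lia. Qed.

Definition weight (u v : int) p : int := u * p.1%:Z + v * p.2%:Z.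

Definition generic M u v := forall p q, (p.1 < M)%N -> (p.2 < M)%N ->
  (q.1 < M)%N -> (q.2 < M)%N -> weight u v p = weight u v q -> p = q.

Lemma base_digits (M a b c d : nat) : (a < M)%N -> (c < M)%N ->
  (M * b + a = M * d + c)%N -> a = c /\ b = d.
Proof.
move=> aM cM E; have M0 : (0 < M)%N by apply: leq_trans aM.
split.
  have := congr1 (modn^~ M) E.
  by rewrite /= !(mulnC M) !modnMDl !modn_small.
have := congr1 (divn^~ M) E.
by rewrite /= !(mulnC M) !divnMDl // !divn_small // !addn0.
Qed.

(** After moving negative terms across, an equality of weights is an equality of two expansions in
    base [M]. *)
Lemma generic_weights (M : nat) (s : int) : s = 1 \/ s = - 1 ->
  [/\ generic M s M%:Z, generic M s (- M%:Z), generic M M%:Z s &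
      generic M (- M%:Z) s].
Proof.
move=> hs; split=> -[p1 p2] [q1 q2] /= p1M p2M q1M q2M; rewrite /weight /= => E.
- suff [-> ->] : p1 = q1 /\ p2 = q2 by [].
  case: hs E => -> E; [|have [-> ->] : q1 = p1 /\ p2 = q2; last by []];
    apply: (@base_digits M) => //; lia.
- suff [-> ->] : p1 = q1 /\ q2 = p2 by [].
  case: hs E => -> E; [|have [-> ->] : q1 = p1 /\ q2 = p2; last by []];
    apply: (@base_digits M) => //; lia.
- suff [-> ->] : p2 = q2 /\ p1 = q1 by [].
  case: hs E => -> E; [|have [-> ->] : q2 = p2 /\ p1 = q1; last by []];
    apply: (@base_digits M) => //; lia.
- suff [-> ->] : p2 = q2 /\ q1 = p1 by [].
  case: hs E => -> E; [|have [-> ->] : q2 = p2 /\ q1 = p1; last by []];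
    apply: (@base_digits M) => //; lia.
Qed.

Lemma extreme_position u v (E : seq (nat * nat)) : E <> [::] ->
  {in E &, injective (weight u v)} ->
  exists2 i, i \in E & forall j, j \in E -> j <> i -> weight u v j < weight u v i.
Proof.
elim: E => // p [|q E] ih _ inj.
  by exists p; rewrite ?inE // => j; rewrite inE => /eqP.
have [//||i iE hi] := ih.
  by move=> j k jE kE; apply: inj; rewrite inE ?jE ?kE orbT.
have [hp|hp|hp] := ltgtP (weight u v p) (weight u v i).
- exists i; first by rewrite inE iE orbT.
  by move=> j; rewrite inE => /orP[/eqP->//|]; exact: hi.
- exists p; first by rewrite inE eqxx.
  move=> j; rewrite inE => /orP[/eqP->//|jE] _.
  have [->//|/eqP ji] := eqVneq j i; exact: lt_trans (hi _ jE ji) hp.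
- have pi : p = i by apply: inj => //; rewrite inE ?eqxx ?iE ?orbT.
  exists p; first by rewrite inE eqxx.
  move=> j; rewrite inE => /orP[/eqP->//|jE] jp.
  by rewrite hp; apply: hi => //; rewrite -pi.
Qed.

(** The weight of a word is a combination of the weights of its digits with positive coefficients,
    and the constant word maximizes every term. So extremality at level one passes to all levels. *)
Lemma extreme_word N (E : seq (nat * nat)) u v i n : (0 < N)%N -> i \in E ->
  (forall j, j \in E -> j <> i -> weight u v j < weight u v i) ->
  forall p, p \in words N E n -> p <> word_pos N (fun=> i) n ->
  weight u v p < weight u v (word_pos N (fun=> i) n).
Proof.
move=> N0 iE hi; elim: n => [|n ih] p /=; first by rewrite inE => /eqP->.
move=> /allpairsP[[c d] [/= cE dE ->]] hp.
set k := word_pos N (fun=> i) n in ih hp *.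
have wD p1 p2 : weight u v (N ^ n * p1.1 + p2.1, N ^ n * p1.2 + p2.2)%N =
    (N ^ n)%:Z * weight u v p1 + weight u v p2.
  by rewrite /weight /= !PoszD !PoszM; ring.
have K0 : (0 : int) < (N ^ n)%:Z by rewrite ltz_nat expn_gt0 N0.
have dk : weight u v d <= weight u v k.
  by have [->//|/eqP dk] := eqVneq d k; exact/ltW/ih.
rewrite !wD; have [ci|/eqP ci] := eqVneq c i; last first.
  by apply: ltr_leD => //; rewrite ltr_pM2l //; exact: hi.
have [dk'|/eqP dk'] := eqVneq d k; first by case: hp; rewrite ci dk'.
by rewrite ci ltrD2l; exact: ih.
Qed.

(** The point [e] also lies in the copy of [F] translated by the integer vector [(d1, d2)], a
    neighbour on the side where the weight is negative. *)
Definition port F u v (e : R * R) := exists f (d1 d2 : int), [/\ F f,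
  e.1 = f.1 + d1%:~R, e.2 = f.2 + d2%:~R & u * d1 + v * d2 < 0].

Lemma rest_port F M E i e u v : (0 < M)%N ->
  (forall j, j \in E -> j <> i -> weight u v j < weight u v i) ->
  rest M E i F (cell M i e) -> port F u v e.
Proof.
move=> M0 hi /restP[j [f [jE ji Ff /(cell_eq M0)[e1 e2]]]].
exists f, (j.1%:Z - i.1%:Z), (j.2%:Z - i.2%:Z); split=> //.
- by rewrite rmorphB /= -?pmulrn addrA -e1 addrK.
- by rewrite rmorphB /= -?pmulrn addrA -e2 addrK.
- by have := hi _ jE ji; rewrite /weight; lia.
Qed.

Lemma expn_gt1 (M n : nat) : (1 < M)%N -> (0 < n)%N -> (1 < M ^ n)%N.
Proof. by move=> M1 n0; have := ltn_exp2l 0 n M1; rewrite expn0 n0. Qed.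

Lemma iter_cell M i n z : (0 < M)%N ->
  cell (M ^ n) (word_pos M (fun=> i) n) z = iter n (cell M i) z.
Proof.
move=> M0; elim: n => [|n ih]; first by rewrite expn0 cell1.
by rewrite cell_word_posS // ih.
Qed.

(** A repetition would make some iterate of the cell map fix both [z] and [cell M i z], which a
    contraction cannot do. *)
Lemma iter_cell_inj M i z : (1 < M)%N -> cell M i z <> z ->
  injective (fun n => iter n (cell M i) z).
Proof.
move=> M1 iz; have M0 := ltnW M1.
have inj n : injective (iter n (cell M i)).
  by elim: n => // n ih z1 z2 /(cell_inj M0) /ih.
suff key k n : iter n (cell M i) z = iter (n + k.+1) (cell M i) z -> False.
  move=> m n E; have [mn|nm|//] := ltngtP m n.
    by case: (key (n - m).-1 m); rewrite E; congr iter; lia.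
  by case: (key (m - n).-1 n); rewrite -E; congr iter; lia.
rewrite iterD => /inj /esym E; apply: iz; apply: contrapT => ne.
have E' : iter k.+1 (cell M i) (cell M i z) = cell M i z.
  by rewrite -iterSr iterS E.
have d0 : 0 < `|cell M i z - z| by rewrite normr_gt0 subr_eq0; apply/eqP.
have : `|cell M i z - z| = `|cell M i z - z| / (M ^ k.+1)%:R.
  by rewrite -{1}E' -{2}E -!iter_cell // cell_dist // expn_gt0 M0.
have : (1 : R) < (M ^ k.+1)%:R.
  by rewrite ltr1n; exact: expn_gt1.
move=> h1 h2; have : `|cell M i z - z| / (M ^ k.+1)%:R < `|cell M i z - z|.
  by rewrite ltr_pdivrMr ?(lt_trans ltr01) // ltr_pMr.
by rewrite -h2 ltxx.
Qed.

(** Take the extreme cell [i] in the generic direction. If it fixes [x], then [hfix] provides the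
    port. Otherwise the images of [x] under its iterates are infinitely many, so one is not a cut
    point and [not_cut_contact] applies; all other cells at that level have smaller weight. *)
Lemma class_has_port F M E x a b u v : tiling M E F -> (1 < M)%N ->
  finite_set (cut F) -> F x -> (F `\ x) a -> (F `\ x) b -> ~ conn F x a b ->
  (forall i, i \in E -> cell M i x = x -> rest M E i F (cell M i a)) ->
  generic M u v -> exists2 e, conn F x a e & port F u v e.
Proof.
move=> T M1 fin Fx Fa Fb nab hfix gen; have M0 := tiling_gt0 T.
have [||i iE hi] := @extreme_position u v E.
- by move=> E0; have [p [f []]] := (tilingE T x).1 Fx; rewrite E0.
- by move=> p q /(tiling_lt T)[? ?] /(tiling_lt T)[? ?]; exact: gen.
have [ix|ix] := pselect (cell M i x = x).
  exists a; first by case: Fa => ? ?; exact: conn_refl.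
  exact: rest_port hi (hfix _ iE ix).
have [n n1 ncut] := finite_escape 1 fin (iter_cell_inj M1 ix).
have Tn := tiling_words M0 n T.
have Mn1 : (1 < M ^ n)%N.
  exact: expn_gt1.
rewrite -iter_cell // in ncut.
have wE : word_pos M (fun=> i) n \in words M E n by apply: word_pos_words.
have [e ae re] := not_cut_contact Tn Mn1 ncut wE Fx Fa Fb nab.
by exists e => //; apply: rest_port re; [exact: tiling_gt0 Tn|exact: extreme_word].
Qed.

(** Small cells around the fixed point [y] exclude [a] and [b], so both classes must enter such a
    cell through contacts with other cells. *)
Lemma fixed_contacts F M E i y a b : tiling M E F -> (1 < M)%N -> i \in E ->
  F y -> cell M i y = y -> (F `\ y) a -> (F `\ y) b -> ~ conn F y a b ->
  exists n, forall m, (n <= m)%N -> let w := word_pos M (fun=> i) m in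
    exists a' b', [/\ F a' /\ F b',
      rest (M ^ m) (words M E m) w F (cell (M ^ m) w a'),
      rest (M ^ m) (words M E m) w F (cell (M ^ m) w b') &
      ~ conn F y (cell (M ^ m) w a') (cell (M ^ m) w b')].
Proof.
move=> T M1 iE Fy iy Fa Fb nab; have M0 := tiling_gt0 T.
have wy m : cell (M ^ m) (word_pos M (fun=> i) m) y = y.
  by rewrite iter_cell //; elim: m => //= m ->.
have far z : (F `\ y) z -> exists n, forall m, (n <= m)%N ->
    ~ (cell (M ^ m) (word_pos M (fun=> i) m) @` F) z.
  move=> [Fz zy]; have d0 : 0 < `|z - y| by rewrite normr_gt0 subr_eq0; apply/eqP.
  have [n hn] := expn_inv_lt M1 d0; exists n => m nm [f Ff zf].
  have := hn _ nm; rewrite ltNge -zf -[X in _ - X](wy m) cell_dist ?expn_gt0 ?M0 //.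
  rewrite ler_piMl ?invr_ge0 ?ler0n //.
  by apply: unit_square_dist; exact: (tiling_square T).
have [na ha] := far _ Fa; have [nb hb] := far _ Fb.
(* The successor makes [m] positive, hence [M ^ m > 1]. *)
exists (maxn na nb).+1 => m nm w; have Tm := tiling_words M0 m T.
have Mm1 : (1 < M ^ m)%N by apply: expn_gt1 => //; lia.
have wE : w \in words M E m by apply: word_pos_words.
have [||a' [Fa' ra aa']] := fixed_contact Tm Mm1 wE Fy (wy m) (a := a).
- by case: Fa.
- by apply: ha; lia.
have [||b' [Fb' rb bb']] := fixed_contact Tm Mm1 wE Fy (wy m) (a := b).
- by case: Fb.
- by apply: hb; lia.
exists a', b'; split=> // h; apply: nab.
by apply: conn_trans aa' _; apply: conn_trans h _; exact: conn_sym.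
Qed.

(** Normalizes the representatives of two classes so that the hypothesis [hfix] of [class_has_port]
    holds for both, at the price of passing to a power of the digit set. *)
Lemma cut_with_contact F M E y : tiling M E F -> (1 < M)%N -> cut F y ->
  exists M' E' a b, [/\ tiling M' E' F /\ (1 < M')%N, (F `\ y) a, (F `\ y) b,
    ~ conn F y a b & forall i, i \in E' -> cell M' i y = y ->
      rest M' E' i F (cell M' i a) /\ rest M' E' i F (cell M' i b)].
Proof.
move=> T M1 [Fy [a [b [Fa Fb nab]]]].
have [[i iE iy]|no] := pselect (exists2 i, i \in E & cell M i y = y); last first.
  by exists M, E, a, b; split=> // i iE iy; case: no; exists i.
have M0 := tiling_gt0 T.
have [n0 contacts] := fixed_contacts T M1 iE Fy iy Fa Fb nab.
pose n := n0.+1; pose w := word_pos M (fun=> i) n.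
have [a' [b' [[Fa' Fb'] ra rb nab']]] := contacts n (leqnSn _).
have Tn := tiling_words M0 n T.
have wE : w \in words M E n by apply: word_pos_words.
have wy : cell (M ^ n) w y = y by rewrite iter_cell //; elim: (n) => //= k ->.
have nry := fixed_not_rest Tn wE Fy wy.
exists (M ^ n)%N, (words M E n), a', b'; split=> //.
- by split=> //; exact: expn_gt1.
- by split=> // a'y; apply: nry; rewrite a'y wy in ra.
- by split=> // b'y; apply: nry; rewrite b'y wy in rb.
- by move=> /(conn_cell Tn wE); rewrite wy.
- move=> j jE jy; suff -> : j = w by [].
  exact: (fixed_cell_unique Tn jE wE Fy Fy jy wy).
Qed.

End Ports.

(** * Classes that span the square *)

Section SpanningClasses.
Context {R : realType}.
Implicit Types (a b x y z : R * R) (p q i j : nat * nat) (A B P Q F : set (R * R)).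

Lemma conn_joined_class F x a b : conn F x a b -> joined (conn F x a) a b.
Proof.
move=> [Q [cQ nQ QF Qa Qb]]; exists Q; split=> // w Qw.
by exists Q.
Qed.

Lemma joined_class F x a l r : conn F x a l -> conn F x a r ->
  joined (conn F x a) l r.
Proof.
move=> /conn_joined_class al /conn_joined_class ar.
exact: joined_trans (joined_sym al) ar.
Qed.

Lemma joined_crossing F A B l r u v : F `<=` unit_square -> A `<=` F -> B `<=` F ->
  (forall z, A z -> ~ B z) -> joined A l r -> joined B u v ->
  l.1 = 0 -> r.1 = 1 -> above l.2 r.2 u -> below l.2 r.2 v -> False.
Proof.
move=> sF AF BF dis [P [cP nP PA Pl Pr]] [Q [cQ nQ QB Qu Qv]] l1 r1.
apply: (spanning_separates cP nP cQ nQ) => //.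
- by move=> z /PA /dis h /QB.
- by move=> z /PA /AF /sF.
- by move=> z /QB /BF /sF.
- by rewrite -l1 -surjective_pairing.
- by rewrite -r1 -surjective_pairing.
Qed.

Section Spanning.
Variables (F : set (R * R)) (M : nat) (E : seq (nat * nat)).
Hypotheses (T : tiling M E F) (M1 : (1 < M)%N).
Variable x : R * R.
Hypothesis Fx : F x.

Let class_sub a : conn F x a `<=` F.
Proof. by move=> z /connP[]. Qed.

(* Outside its class, [e] would be joined to [v] through [x], crossing the
   spanning class of [a]. *)
Lemma above_spanning a l r v e : conn F x a l -> conn F x a r ->
  l.1 = 0 -> r.1 = 1 -> F v -> v <> x -> ~ conn F x a v -> below l.2 r.2 v ->
  F e -> e <> x -> above l.2 r.2 e -> conn F x a e.
Proof.
move=> al ar l1 r1 Fv vx nav bv Fe ex ae; apply: contrapT => nae.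
have [P [cP nP PA Pl Pr]] := joined_class al ar.
have Px : ~ P x by move=> /PA /connP[].
have center w : F w -> w <> x -> ~ conn F x a w -> joined (F `&` ~` P) x w.
  move=> Fw wx naw; apply: (join_to_center T M1) => //.
    exact: compact_closed_plane cP.
  by move=> z /PA az wz; apply: naw; apply: conn_trans az (conn_sym wz).
have ev := joined_trans (joined_sym (center _ Fe ex nae)) (center _ Fv vx nav).
apply: (joined_crossing (tiling_square T) (A := P) (B := F `&` ~` P)
  (l := l) (r := r)) ev l1 r1 ae bv.
- by move=> z /PA /class_sub.
- by move=> z [].
- by move=> z Pz [].
- by exists P; split.
Qed.

Lemma below_spanning a l r v e : conn F x a l -> conn F x a r ->
  l.1 = 0 -> r.1 = 1 -> F v -> v <> x -> ~ conn F x a v -> above l.2 r.2 v ->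
  F e -> e <> x -> below l.2 r.2 e -> conn F x a e.
Proof.
move=> al ar l1 r1 Fv vx nav bv Fe ex ae; apply: contrapT => nae.
by apply: nav; apply: above_spanning al ar l1 r1 Fe ex nae ae Fv vx bv.
Qed.

(** In a nearly vertical generic direction, neighbours in one adjacent row have the wrong weight and
    those in the other are excluded by [side]; only the horizontal neighbour on the side of [- s]
    remains. *)
Lemma horizontal_port a b (s : int) : finite_set (cut F) -> s = 1 \/ s = - 1 ->
  (F `\ x) a -> (F `\ x) b -> ~ conn F x a b ->
  (forall i, i \in E -> cell M i x = x -> rest M E i F (cell M i a)) ->
  (forall e, F e -> e.2 = 0 -> ~ conn F x a e) \/
  (forall e, F e -> e.2 = 1 -> ~ conn F x a e) ->
  exists e f, [/\ conn F x a e, F f, e.1 = f.1 - s%:~R & e.2 = f.2].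
Proof.
move=> fin hs Fa Fb nab hfix side.
have [v [gv hv]] : exists v, generic M s v /\ forall d1 d2 : int,
   -1 <= d1 <= 1 -> -1 <= d2 <= 1 -> s * d1 + v * d2 < 0 ->
   [\/ d2 = 0 /\ d1 = - s,
      d2 = 1 /\ forall e, F e -> e.2 = 1 -> ~ conn F x a e |
      d2 = - 1 /\ forall e, F e -> e.2 = 0 -> ~ conn F x a e].
  have [g1 g2 _ _] := generic_weights M hs.
  (* Since [M > 1], a nonzero [d2] decides the sign. The weight excludes the row above when the
     class misses the bottom, and the row below when it misses the top. *)
  case: side => side; [exists M%:Z|exists (- M%:Z)]; split=> // d1 d2 h1
    /int_sign_cases[|[]] E2 h; try (by apply: Or32); try (by apply: Or33).
  - by apply: Or31; split=> //; case: hs h => ->; rewrite E2; lia.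
  - by exfalso; case: hs h => ->; rewrite E2; lia.
  - by apply: Or31; split=> //; case: hs h => ->; rewrite E2; lia.
  - by exfalso; case: hs h => ->; rewrite E2; lia.
have [e ae [f [d1 [d2 [Ff e1 e2 d]]]]] :=
  class_has_port T M1 fin Fx Fa Fb nab hfix gv.
have [_ _ Fe _] := connP ae.
have [/andP[? ?] /andP[? ?]] := tiling_square T Fe.
have [/andP[? ?] /andP[? ?]] := tiling_square T Ff.
have bound (n : int) (t w : R) : 0 <= t -> t <= 1 -> 0 <= w -> w <= 1 ->
    t = w + n%:~R -> -1 <= n <= 1.
  move=> ? ? ? ? h; have h' : (n%:~R : R) = t - w by rewrite h addrC addKr.
  by apply/andP; split; rewrite -(ler_int R) h' ?mulrNz; lra.
have b1 : -1 <= d1 <= 1 by apply: bound e1.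
have b2 : -1 <= d2 <= 1 by apply: bound e2.
have [[E2 E1]|[E2 no]|[E2 no]] := hv d1 d2 b1 b2 d.
- exists e, f; split=> //; first by rewrite e1 E1 rmorphN.
  by rewrite e2 E2 addr0.
- by exfalso; apply: (no e) => //; rewrite E2 /= in e2; lra.
- by exfalso; apply: (no e) => //; rewrite E2 /= in e2; lra.
Qed.

End Spanning.

End SpanningClasses.

(** * Images of cut points in a cell fixing a cut point *)

Section FixedCell.
Context {R : realType}.
Implicit Types (a b x y z : R * R) (p q i j : nat * nat) (A B P Q F : set (R * R)).

(** Cells in different rows meet only along top or bottom sides, and distinct cells of one row only
    along vertical sides, which [no] rules out. *)
Lemma contact_bounds F M E i e : tiling M E F -> F e ->
  (forall j f, j \in E -> F f -> cell M i e = cell M j f -> i.2 = j.2 ->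
    e.1 = f.1 - 1 \/ e.1 = f.1 + 1 -> False) ->
  rest M E i F (cell M i e) -> e.2 = 1 \/ e.2 = 0.
Proof.
move=> T Fe no /restP[j [f [jE ji Ff ef]]].
have [e1 e2] := cell_eq (tiling_gt0 T) ef.
have [/andP[? ?] /andP[? ?]] := tiling_square T Fe.
have [/andP[? ?] /andP[? ?]] := tiling_square T Ff.
have lt_nat (k l : nat) : (k < l)%N -> (k%:R : R) + 1 <= l%:R.
  by move=> kl; rewrite natr1 ler_nat.
have [/lt_nat h|/lt_nat h|ij2] := ltngtP i.2 j.2.
- by left; lra.
- by right; lra.
have ij1 : i.1 <> j.1.
  move=> ij1; apply: ji.
  by rewrite (surjective_pairing i) (surjective_pairing j) ij1 ij2.
exfalso; apply: (no j f jE Ff ef ij2).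
have [/lt_nat h|/lt_nat h|//] := ltngtP i.1 j.1.
- by right; lra.
- by left; lra.
Qed.

(* [a] and [b] lie in the upper and the lower of two classes of [F `\ x] that
   span the square horizontally. *)
Lemma cut_image_spanning F M E i x y a b l1 r1 l2 r2 :
  tiling M E F -> (1 < M)%N -> finite_set (cut F) ->
  i \in E -> F x -> cell M i x = x -> F a -> F b ->
  rest M E i F (cell M i a) -> rest M E i F (cell M i b) ->
  ~ conn F x (cell M i a) (cell M i b) ->
  conn F x a l1 -> conn F x a r1 -> conn F x b l2 -> conn F x b r2 ->
  l1.1 = 0 -> r1.1 = 1 -> l2.1 = 0 -> r2.1 = 1 -> l2.2 < l1.2 ->
  cut F y -> y <> x -> ~ conn F x a y -> cut F (cell M i y).
Proof.
move=> T M1 fin iE Fx ix Fa Fb ra rb nab' al1 ar1 bl2 br2 El1 Er1 El2 Er2 l21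
  cy yx nay; have M0 := tiling_gt0 T; have sF := tiling_square T.
have inj := @cell_inj R M M0 i.
have conn_i c d : conn F x c d -> conn F x (cell M i c) (cell M i d).
  by move=> /(conn_cell T iE); rewrite ix.
have nab : ~ conn F x a b by move=> /conn_i.
have [_ ax Fl1 l1x] := connP al1; have [_ _ Fr1 r1x] := connP ar1.
have [_ bx Fl2 l2x] := connP bl2; have [_ _ Fr2 r2x] := connP br2.
have notab c : conn F x a c -> ~ conn F x b c.
  by move=> ac bc; apply: nab; apply: conn_trans ac (conn_sym bc).
have nal2 : ~ conn F x a l2 by move=> /notab.
have nbl1 : ~ conn F x b l1 by move=> h; exact: (notab _ al1 h).
(* If the right ends were in the opposite order, the two spanning classes would cross. *)
have r21 : r2.2 < r1.2.
  have [//|r12|E12] := ltgtP r2.2 r1.2; exfalso.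
    apply: (joined_crossing sF (A := conn F x a) (B := conn F x b) (l := l1)
      (r := r1) (u := r2) (v := l2)) => //.
    - by move=> z /connP[].
    - by move=> z /connP[].
    - exact: (joined_class al1 ar1).
    - exact: (joined_class br2 bl2).
    - by apply: Or33.
    - by apply: Or32.
  suff E' : r1 = r2 by apply: (notab r1 ar1); rewrite E'.
  by rewrite (surjective_pairing r1) (surjective_pairing r2) Er1 Er2 E12.
have up e : F e -> e <> x -> above l1.2 r1.2 e -> conn F x a e.
  apply: (above_spanning T M1 Fx al1 ar1 El1 Er1 Fl2 l2x nal2).
  by apply: Or32.
have down e : F e -> e <> x -> below l2.2 r2.2 e -> conn F x b e.
  apply: (below_spanning T M1 Fx bl2 br2 El2 Er2 Fl1 l1x nbl1).
  by apply: Or32.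
have top e : F e -> e <> x -> e.2 = 1 -> conn F x a e.
  by move=> Fe ex e2; apply: up => //; apply: Or31.
have bot e : F e -> e <> x -> e.2 = 0 -> conn F x b e.
  by move=> Fe ex e2; apply: down => //; apply: Or31.
have fixcell j : j \in E -> cell M j x = x -> j = i.
  by move=> jE jx; exact: (fixed_cell_unique T jE iE Fx Fx jx ix).
have porta (s : int) : s = 1 \/ s = - 1 ->
    exists e f, [/\ conn F x a e, F f, e.1 = f.1 - s%:~R & e.2 = f.2].
  move=> hs; apply: (horizontal_port T M1 Fx fin hs (b := b)) => //.
    by move=> j jE /(fixcell j jE) ->.
  left=> e Fe e2 ae; apply: (notab e ae); apply: bot => //.
  by have [] := connP ae.
have portb (s : int) : s = 1 \/ s = - 1 ->
    exists e f, [/\ conn F x b e, F f, e.1 = f.1 - s%:~R & e.2 = f.2].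
  move=> hs; apply: (horizontal_port T M1 Fx fin hs (b := a)) => //.
  - by move=> /conn_sym.
  - by move=> j jE /(fixcell j jE) ->.
  right=> e Fe e2 be; apply: (notab e) => //; apply: top => //.
  by have [] := connP be.
(* A neighbour [j] in the same row would touch the images of both classes, by [porta] and [portb] on
   that side. As cell [j] avoids [x], it would join them, against [nab']. *)
have contact e : F e -> rest M E i F (cell M i e) -> e.2 = 1 \/ e.2 = 0.
  move=> Fe; apply: (contact_bounds T Fe) => j f jE Ff ef ij2 h.
  have [s hs e1] : exists2 s : int, s = 1 \/ s = - 1 & e.1 = f.1 - s%:~R.
    by case: h => h; [exists 1|exists (- 1)]; rewrite ?rmorphN ?opprK; auto.
  have [ij1 _] := cell_eq M0 ef.
  have ji : j <> i.
    move=> ji; rewrite ji e1 in ij1.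
    have s0 : (s%:~R : R) == 0 by apply/eqP; lra.
    by rewrite intr_eq0 in s0; case: hs s0 => ->.
  have glue (c d : R * R) : c.1 = d.1 - s%:~R -> c.2 = d.2 -> cell M i c = cell M j d.
    have Ei : (i.1%:R : R) = j.1%:R + s%:~R.
      by apply: (addrI e.1); rewrite ij1 e1; ring.
    move=> c1 c2; rewrite /cell c1 c2 ij2 Ei; congr pair; congr (_ / _); ring.
  have [ea [fa [aea Ffa ea1 ea2]]] := porta s hs.
  have [eb [fb [beb Ffb eb1 eb2]]] := portb s hs.
  apply: nab'; apply: conn_trans (conn_i _ _ aea) _.
  apply: conn_trans _ (conn_sym (conn_i _ _ beb)).
  exists (cell M j @` F); split.
  - apply: compact_image (tiling_compact T); exact: continuous_cell.
  - apply: connected_image (tiling_connected T); exact: continuous_cell.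
  - move=> _ [g Fg <-]; split; first exact: (tiling_cell T _ _).
    by move=> gx; apply: ji; apply/esym; apply: (fixed_cell_unique T iE jE Fx Fg ix gx).
  - by exists fa => //; apply/esym; exact: glue.
  - by exists fb => //; apply/esym; exact: glue.
have [Fy _] := cy.
have [M' [E' [u [v [[T' M1'] Fu Fv nuv huv]]]]] := cut_with_contact T M1 cy.
(* Of two classes of F \ y at least one does not contain [x]; [k] is taken there. *)
have [k [k' [Fk Fk' nkk' nkx hk]]] : exists k k', [/\ (F `\ y) k, (F `\ y) k',
    ~ conn F y k k', ~ conn F y k x &
    forall j, j \in E' -> cell M' j y = y -> rest M' E' j F (cell M' j k)].
  have [ux|ux] := pselect (conn F y u x); last first.
    by exists u, v; split=> // j jE jy; have [] := huv j jE jy.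
  exists v, u; split=> //; first by move=> /conn_sym.
    by move=> vx; apply: nuv; apply: conn_trans ux (conn_sym vx).
  by move=> j jE jy; have [] := huv j jE jy.
have switch e : conn F x a e -> conn F y x e.
  move=> ae; have [_ _ Fe ex] := connP ae.
  apply: (conn_switch T M1) => // ey; apply: nay; exact: conn_trans ae ey.
(* Apart from [x], the top lies in the class of [a], which is joined to [x] in F \ y. Hence the
   class of [k] misses the top and spans horizontally. *)
have ktop e : F e -> e.2 = 1 -> ~ conn F y k e.
  move=> Fe e2 ke; have [ex|/eqP ex] := eqVneq e x; first by apply: nkx; rewrite -ex.
  by apply: nkx; apply: conn_trans ke (conn_sym (switch _ (top _ Fe ex e2))).
have portk (s : int) : s = 1 \/ s = - 1 ->
    exists e f, [/\ conn F y k e, F f, e.1 = f.1 - s%:~R & e.2 = f.2].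
  by move=> hs; apply: (horizontal_port T' M1' Fy fin hs Fk Fk') => //; right.
have [l3 [g3 [kl3 Fg3 El3 _]]] := portk 1 (or_introl erefl).
have [r3 [h3 [kr3 Fh3 Er3 _]]] := portk (- 1) (or_intror erefl).
have [_ ky Fl3 l3y] := connP kl3; have [_ _ Fr3 r3y] := connP kr3.
have {Fg3}El3 : l3.1 = 0.
  have [/andP[? ?] _] := sF _ Fl3; have [/andP[? ?] _] := sF _ Fg3.
  by rewrite /= in El3; lra.
have {Fh3}Er3 : r3.1 = 1.
  have [/andP[? ?] _] := sF _ Fr3; have [/andP[? ?] _] := sF _ Fh3.
  by rewrite rmorphN /= in Er3; lra.
have l3x : l3 <> x by move=> E3; apply: nkx; rewrite -E3.
have nal3 : ~ conn F x a l3.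
  by move=> /switch xl3; apply: nkx; apply: conn_trans kl3 (conn_sym xl3).
have l31 : l3.2 < l1.2.
  have [//|l13|E13] := ltgtP l3.2 l1.2; exfalso; apply: nal3.
    by apply: up => //; apply: Or32.
  suff -> : l3 = l1 by [].
  by rewrite (surjective_pairing l3) (surjective_pairing l1) El3 El1 E13.
(* The class of [k] spans below [l1], so it separates the bottom from the class of [x] in F \ y. *)
have xbot e : F e -> e.2 = 0 -> ~ conn F y x e.
  move=> Fe e2 xe.
  apply: (joined_crossing sF (A := conn F y k) (B := conn F y x) (l := l3)
    (r := r3) (u := l1) (v := e)) => //.
  - by move=> z /connP[].
  - by move=> z /connP[].
  - by move=> z kz xz; apply: nkx; apply: conn_trans kz (conn_sym xz).
  - exact: joined_class.
  - by apply: joined_class => //; exact: switch.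
  - by apply: Or32.
  - by apply: Or31.
have conn_a e : F e -> e <> x -> e.2 = 1 -> conn F x (cell M i a) (cell M i e).
  by move=> Fe ex e2; apply: conn_i; exact: top.
have nconn_b e : F e -> e <> x -> e.2 = 0 -> ~ conn F x (cell M i a) (cell M i e).
  move=> Fe ex e2 ae; apply: nab'; apply: conn_trans ae (conn_sym _).
  by apply: conn_i; exact: bot.
have nrx : ~ rest M E i F x by exact: (fixed_not_rest T iE Fx ix).
have rest_neq e : rest M E i F (cell M i e) -> e <> x.
  by move=> re ex; apply: nrx; rewrite -ix -ex.
have kx : k <> x by move=> kx; apply: nkx; rewrite -kx; apply: conn_refl; case: Fk.
have [Fk0 _] := Fk.
apply: contrapT => nc.
have [Q [_ nQ QF Qx Qk]] : conn F (cell M i y) x (cell M i k).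
  apply: contrapT => nxk; apply: nc; split; first exact: (tiling_cell T _ _).
  exists x, (cell M i k); split=> //.
    by split=> // xy; apply: yx; apply: inj; rewrite ix -xy.
  by split; [exact: (tiling_cell T _ _)|move=> /inj].
(* [U] collects, inside the cell, the image of the class of [x] in F \ y and, outside it, the class
   of [cell M i a] in F \ x, with [y] and [x] added for closedness; [W] collects the remaining
   points. At contacts the two descriptions agree, since top contacts go to [U] and bottom ones to
   [W]. So [Q] cannot lead from [x] to the image of [k]. *)
pose U := cell M i @` (conn F y x `|` [set y]) `|`
  (rest M E i F `&` (conn F x (cell M i a) `|` [set x])).
pose W := cell M i @` (F `&` ~` conn F y x) `|`
  (rest M E i F `&` (F `&` ~` conn F x (cell M i a))).
have compact_sub A : closed A -> A `<=` F -> compact A.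
  by move=> cA AF; exact: (subclosed_compact cA (tiling_compact T) AF).
have closed_img A : closed A -> A `<=` F -> closed (cell M i @` A).
  move=> cA AF; apply: compact_closed_plane; apply: compact_image.
    exact: continuous_cell.
  exact: compact_sub.
have cU : closed U.
  apply: closedU; last first.
    by apply: closedI; [exact: (closed_rest T)|exact: (closed_class T M1)].
  apply: closed_img; first exact: (closed_class T M1).
  by move=> z [/connP[]|->].
have cW : closed W.
  apply: closedU; last first.
    by apply: closedI; [exact: (closed_rest T)|exact: (closed_class_compl T M1)].
  by apply: closed_img; [exact: (closed_class_compl T M1)|move=> z []].
have QUW : Q `<=` U `|` W.
  move=> q /QF[Fq qy]; have [[e Fe eq]|rq] := tiling_cell_rest T i Fq.
    have [xe|xe] := pselect (conn F y x e).
      by left; left; exists e => //; left.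
    by right; left; exists e.
  have [aq|aq] := pselect (conn F x (cell M i a) q).
    by left; right; split=> //; left.
  by right; right.
have dis (q : R * R) : Q q -> U q -> ~ W q.
  move=> /QF[Fq qy]; have ny e : cell M i e = q -> e <> y.
    by move=> eq ey; apply: qy; rewrite -eq ey.
  move=> [[e ey eq]|[rq aq]] [[e' [Fe' nxe'] e'q]|[rq' [_ naq]]].
  - have ee : e = e' by apply: inj; rewrite eq.
    by rewrite -ee in nxe'; case: ey => // /(ny _ eq).
  - case: ey => [xe|/(ny _ eq)//]; have [_ _ Fe _] := connP xe.
    rewrite -eq in rq' naq; have ex := rest_neq _ rq'.
    have [e2|e2] := contact _ Fe rq'; first by apply: naq; exact: conn_a.
    exact: xbot e2 xe.
  - case: aq => [aq|qx]; last by apply: nrx; rewrite -qx.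
    rewrite -e'q in rq aq; have ex := rest_neq _ rq.
    have [e2|e2] := contact _ Fe' rq; last exact: nconn_b e2 aq.
    by apply: nxe'; apply: switch; exact: top.
  - case: aq => // qx; by apply: nrx; rewrite -qx.
have : U (cell M i k).
  apply: (connected_split nQ cU cW QUW dis Qx _) Qk.
  by left; exists x => //; left; apply: conn_refl => // /esym.
move=> [[e [xe|ey] /inj ek]|[rk [ak|xk]]].
- by apply: nkx; rewrite -ek; exact: conn_sym.
- by apply: ky; rewrite -ek.
- have [k2|k2] := contact _ Fk0 rk; last exact: nconn_b k2 ak.
  by apply: (ktop k) => //; exact: conn_refl.
- by apply: (rest_neq k) => //; apply: inj; rewrite ix.
Qed.

End FixedCell.

(** * Symmetries of the square and of its grid *)

Section Symmetries.
Context {R : realType}.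
Implicit Types (a b x y z : R * R) (p q i j : nat * nat) (A B P Q F : set (R * R)).

Definition in_grid M p := (p.1 < M)%N /\ (p.2 < M)%N.

(** The action [h] on digits is required to be an involution only on the grid, because the
    reflection uses truncated subtraction. *)
Record grid_symmetry (M : nat) (g : R * R -> R * R) (h : nat * nat -> nat * nat) :
    Prop := GridSymmetry {
  sym_invol : involutive g;
  sym_continuous : continuous g;
  sym_square : forall z, unit_square z -> unit_square (g z);
  sym_grid : forall p, in_grid M p -> in_grid M (h p) /\ h (h p) = p;
  sym_cell : forall p z, in_grid M p -> g (cell M p z) = cell M (h p) (g z) }.

Lemma transpose_symmetry M : grid_symmetry M transpose (fun p => (p.2, p.1)).
Proof.
split.
- exact: transposeK.
- exact: continuous_transpose.
- by move=> z [].
- by move=> [p1 p2] [].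
- by [].
Qed.

Lemma reflect_symmetry M : (0 < M)%N ->
  grid_symmetry M reflect_y (fun p => (p.1, M.-1 - p.2)%N).
Proof.
move=> M0; split.
- exact: reflect_yK.
- exact: continuous_reflect_y.
- by move=> z [h1 h2]; split=> //=; lra.
- by move=> [p1 p2] [/= h1 h2]; split; [split=> /=; lia|congr pair; lia].
- move=> [p1 p2] z [/= _ h2]; rewrite /reflect_y /cell /=; congr pair.
  have -> : ((M.-1 - p2)%N%:R : R) = M%:R - 1 - p2%:R.
    by rewrite -{2}(prednK M0) -natr1 addrK natrB //; lia.
  have Mr0 : (M%:R : R) != 0 by rewrite pnatr_eq0 -lt0n.
  by field.
Qed.

Section Symmetry.
Variables (M : nat) (g : R * R -> R * R) (h : nat * nat -> nat * nat).
Hypothesis S : grid_symmetry M g h.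
Let gK : involutive g := sym_invol S.

Lemma conn_symmetry F x a b :
  conn F x a b <-> conn (g @` F) (g x) (g a) (g b).
Proof.
have key G c d e : conn G c d e -> conn (g @` G) (g c) (g d) (g e).
  apply: joined_image; first exact: sym_continuous S.
  by move=> z [Gz zc]; split; [exists z|move=> /(can_inj gK)].
split; first exact: key.
move=> /key; rewrite !gK; have -> // : g @` (g @` F) = F.
apply/seteqP; split=> [_ [_ [z Fz <-] <-]|z Fz]; first by rewrite gK.
by exists (g z); [exists z|rewrite gK].
Qed.

Lemma mem_symmetry F z : (g @` F) (g z) <-> F z.
Proof.
by split=> [[w Fw /(can_inj gK) <-]|Fz]; [|exists z].
Qed.

Lemma cut_symmetry F z : cut (g @` F) (g z) <-> cut F z.
Proof.
split=> [[/mem_symmetry Fz [a [b [[Fa az] [Fb bz] nab]]]]|].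
  split=> //; exists (g a), (g b); split.
  - split; first by apply/mem_symmetry; rewrite gK.
    by move=> ga; apply: az; rewrite /= -ga gK.
  - split; first by apply/mem_symmetry; rewrite gK.
    by move=> gb; apply: bz; rewrite /= -gb gK.
  - by move=> /conn_symmetry; rewrite !gK.
move=> [Fz [a [b [[Fa az] [Fb bz] nab]]]]; split; first exact/mem_symmetry.
exists (g a), (g b); split.
- by split; [exact/mem_symmetry|move=> /(can_inj gK)].
- by split; [exact/mem_symmetry|move=> /(can_inj gK)].
- by move=> /(conn_symmetry F z a b).2.
Qed.

Lemma finite_cut_symmetry F : finite_set (cut F) -> finite_set (cut (g @` F)).
Proof.
move=> /(finite_image g); apply: sub_finite_set => z; rewrite -(gK z).
by move=> /cut_symmetry cz; exists (g z).
Qed.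

Lemma tiling_symmetry E F : tiling M E F -> tiling M (map h E) (g @` F).
Proof.
move=> T; have gr p : p \in E -> in_grid M p by move=> /(tiling_lt T).
split.
- exact: tiling_gt0 T.
- by move=> _ /mapP[p /gr pE ->]; have [] := sym_grid S pE.
- move=> z; split.
    move=> [w /(tilingE T)[p [f [pE Ff ->]]] <-].
    exists (h p), (g f); split; [exact: map_f|by exists f|].
    exact: (sym_cell S _ (gr _ pE)).
  move=> [_ [_ [/mapP[p pE ->] [f Ff <-] ->]]].
  exists (cell M p f); first exact: (tiling_cell T).
  exact: (sym_cell S _ (gr _ pE)).
- by apply: compact_image (tiling_compact T); exact: sym_continuous S.
- by apply: connected_image (tiling_connected T); exact: sym_continuous S.
- by move=> _ [z /(tiling_square T) sz <-]; exact: sym_square S _ sz.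
Qed.

Lemma rest_symmetry E F i z : tiling M E F -> i \in E ->
  rest M E i F z -> rest M (map h E) (h i) (g @` F) (g z).
Proof.
move=> T iE /restP[j [f [jE ji Ff ->]]]; apply/restP.
have ig := tiling_lt T iE; have jg := tiling_lt T jE.
exists (h j), (g f); split; [exact: map_f| |by exists f|exact: (sym_cell S)].
by move=> E'; apply: ji; rewrite -(sym_grid S jg).2 E' (sym_grid S ig).2.
Qed.

End Symmetry.

End Symmetries.

(** * Horizontal and vertical spanning *)

Section Directions.
Context {R : realType}.
Implicit Types (a b x y z : R * R) (p q i j : nat * nat) (A B P Q F : set (R * R)).

Definition spans_horizontally F x a :=
  exists l r, [/\ conn F x a l, conn F x a r, l.1 = 0 & r.1 = 1].

Definition spans_vertically F x a :=
  exists l r, [/\ conn F x a l, conn F x a r, l.2 = 0 & r.2 = 1].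

(** Four generic directions, one for each corner [(s, t)], show that the class touches one of the
    two sides at every corner. This forces it to touch two opposite sides. *)
Lemma class_spans F M E x a b : tiling M E F -> (1 < M)%N ->
  finite_set (cut F) -> F x -> (F `\ x) a -> (F `\ x) b -> ~ conn F x a b ->
  (forall i, i \in E -> cell M i x = x -> rest M E i F (cell M i a)) ->
  spans_horizontally F x a \/ spans_vertically F x a.
Proof.
move=> T M1 fin Fx Fa Fb nab hfix.
have touch (s t : bool) : exists2 e, conn F x a e &
    e.1 = s%:R \/ e.2 = t%:R.
  pose u : int := if s then - M%:Z else M%:Z.
  pose v : int := if t then - 1 else 1.
  have gen : generic M u v.
    have [_ _ g1 g2] := @generic_weights M 1 (or_introl erefl).
    have [_ _ g3 g4] := @generic_weights M (- 1) (or_intror erefl).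
    by rewrite /u /v; case: (s) (t) => -[].
  have [e ae [f [d1 [d2 [Ff e1 e2 d]]]]] :=
    class_has_port T M1 fin Fx Fa Fb nab hfix gen.
  exists e => //; have [_ _ Fe _] := connP ae.
  have [/andP[? ?] /andP[? ?]] := tiling_square T Fe.
  have [/andP[? ?] /andP[? ?]] := tiling_square T Ff.
  have bound (n : int) (p q : R) : 0 <= p -> p <= 1 -> 0 <= q -> q <= 1 ->
      p = q + n%:~R ->
      [\/ n = 0, n = 1 /\ p = 1 | n = - 1 /\ p = 0].
    move=> p0 p1 q0 q1 pq; have n1 : (n%:~R : R) <= 1%:~R by lra.
    have n2 : ((- 1)%:~R : R) <= n%:~R by rewrite rmorphN; lra.
    rewrite !ler_int in n1 n2.
    have [->|[n0|n0]] : n = 0 \/ n = 1 \/ n = - 1 by apply: int_sign_cases; rewrite n1 n2.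
    - exact: Or31.
    - by apply: Or32; split=> //; rewrite n0 in pq; lra.
    - by apply: Or33; split=> //; rewrite n0 rmorphN in pq; lra.
  have b1 : [\/ d1 = 0, d1 = 1 /\ e.1 = 1 | d1 = - 1 /\ e.1 = 0].
    by apply: bound e1.
  have b2 : [\/ d2 = 0, d2 = 1 /\ e.2 = 1 | d2 = - 1 /\ e.2 = 0].
    by apply: bound e2.
  move: d; rewrite /u /v; case: b1 => [->|[-> E1]|[-> E1]];
    case: b2 => [->|[-> E2]|[-> E2]]; rewrite ?E1 ?E2; case: (s) (t) => -[] d;
    by [left|right|exfalso; move: d M1; clear; lia].
have [e0 a0 h0] := touch false false; have [e1 a1 h1] := touch false true.
have [e2 a2 h2] := touch true false; have [e3 a3 h3] := touch true true.
have [|nh] := pselect (spans_horizontally F x a); [by left|right].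
have tb : (e0.2 = 0 /\ e1.2 = 1) \/ (e2.2 = 0 /\ e3.2 = 1).
  apply: contrapT => no.
  have [[l al l1]|nl] := pselect (exists2 l, conn F x a l & l.1 = 0); last first.
    apply: no; left; split; [case: h0 => // h0|case: h1 => // h1]; case: nl.
      by exists e0.
    by exists e1.
  have [[r ar r1]|nr] := pselect (exists2 r, conn F x a r & r.1 = 1).
    by apply: nh; exists l, r.
  apply: no; right; split; [case: h2 => // h2|case: h3 => // h3]; case: nr.
    by exists e2.
  by exists e3.
by case: tb => -[? ?]; [exists e0, e1|exists e2, e3].
Qed.

End Directions.

(** * Cut points fixed by a cell map, and the reduction to them *)

Section Carpets.
Context {R : realType}.
Implicit Types (a b x y z : R * R) (p q i j : nat * nat) (A B P Q F : set (R * R)).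

(** Bundles a cut point fixed by one cell with contacts of that cell in two classes, so that the
    whole situation can be moved by symmetries. *)
Record critical F M E i x a b : Prop := Critical {
  critical_tiling : tiling M E F;
  critical_gt1 : (1 < M)%N;
  critical_finite : finite_set (cut F);
  critical_digit : i \in E;
  critical_mem : [/\ F x, F a & F b];
  critical_fixed : cell M i x = x;
  critical_rest : rest M E i F (cell M i a) /\ rest M E i F (cell M i b);
  critical_class : ~ conn F x (cell M i a) (cell M i b) }.

Lemma critical_sym F M E i x a b :
  critical F M E i x a b -> critical F M E i x b a.
Proof.
by move=> [T M1 fin iE [Fx Fa Fb] ix [ra rb] nab]; split=> // /conn_sym.
Qed.

Lemma critical_symmetry M g h F E i x a b : grid_symmetry M g h ->
  critical F M E i x a b ->
  critical (g @` F) M (map h E) (h i) (g x) (g a) (g b).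
Proof.
move=> S [T M1 fin iE [Fx Fa Fb] ix [ra rb] nab]; have ig := tiling_lt T iE.
have gi z : cell M (h i) (g z) = g (cell M i z) by rewrite (sym_cell S).
split=> //.
- exact: (tiling_symmetry S T).
- exact: (finite_cut_symmetry S fin).
- exact: map_f.
- by rewrite gi ix.
- by rewrite !gi; split; exact: (rest_symmetry S T iE).
- by rewrite !gi => /(conn_symmetry S F x _ _).2.
Qed.

Lemma critical_conn F M E i x a b : critical F M E i x a b ->
  [/\ a <> x, b <> x & ~ conn F x a b].
Proof.
move=> [T M1 fin iE [Fx Fa Fb] ix [ra rb] nab].
have nrx := fixed_not_rest T iE Fx ix; split.
- by move=> ax; apply: nrx; rewrite ax ix in ra.
- by move=> bx; apply: nrx; rewrite bx ix in rb.
- by move=> /(conn_cell T iE); rewrite ix.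
Qed.

Lemma cut_image_horizontal F M E i x y a b : critical F M E i x a b ->
  spans_horizontally F x a -> spans_horizontally F x b ->
  cut F y -> y <> x -> cut F (cell M i y).
Proof.
move=> C sa sb cy yx.
(* The classes of [a] and [b] are disjoint, so [y] misses one of them. *)
wlog nay : a b C sa sb / ~ conn F x a y.
  move=> gen; have [ay|] := pselect (conn F x a y); last exact: gen C sa sb.
  apply: (gen b a) => //; first exact: critical_sym.
  have [_ _ nab] := critical_conn C.
  by move=> yb; apply: nab; apply: conn_trans ay (conn_sym yb).
have [_ _ nab'] := critical_conn C.
have [T M1 fin iE [Fx Fa Fb] ix [ra rb] nab] := C.
move: sa sb => [l1 [r1 [al1 ar1 El1 Er1]]] [l2 [r2 [bl2 br2 El2 Er2]]].
have [l21|l12|E12] := ltgtP l2.2 l1.2.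
- exact: (cut_image_spanning T M1 fin iE Fx ix Fa Fb ra rb nab al1 ar1 bl2 br2).
(* Here the class of [a] is the lower one; reflecting the square turns it into the upper one. *)
- have S := @reflect_symmetry R M (tiling_gt0 T).
  have [T' _ fin' iE' [Fx' Fa' Fb'] ix' [ra' rb'] nab1] := critical_symmetry S C.
  have conn' c d : conn F x c d -> conn (reflect_y @` F) (reflect_y x)
      (reflect_y c) (reflect_y d) by move=> /(conn_symmetry S).
  apply/(cut_symmetry S F (cell M i y)); rewrite (sym_cell S); last exact: (tiling_lt T).
  apply: (cut_image_spanning T' M1 fin' iE' Fx' ix' Fa' Fb' ra' rb' nab1
    (conn' _ _ al1) (conn' _ _ ar1) (conn' _ _ bl2) (conn' _ _ br2)) => //.
  + by rewrite /=; lra.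
  + exact: (cut_symmetry S F y).2.
  + by move=> /(can_inj (sym_invol S)).
  + by move=> /(conn_symmetry S F x a y).2.
- exfalso; apply: nab'; apply: conn_trans al1 _; apply: conn_sym.
  suff -> : l1 = l2 by [].
  by rewrite (surjective_pairing l1) (surjective_pairing l2) El1 El2 E12.
Qed.

Lemma spans_not_transverse F M E x a b : tiling M E F ->
  spans_horizontally F x a -> spans_vertically F x b -> conn F x a b.
Proof.
move=> T [l [r [al ar l1 r1]]] [v [u [bv bu v2 u2]]]; apply: contrapT => nab.
apply: (joined_crossing (tiling_square T) (A := conn F x a) (B := conn F x b)
  (l := l) (r := r) (u := u) (v := v)) => //.
- by move=> z /connP[].
- by move=> z /connP[].
- by move=> z az bz; apply: nab; exact: conn_trans az (conn_sym bz).
- exact: (joined_class al ar).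
- exact: (joined_class bu bv).
- exact: Or31.
- exact: Or31.
Qed.

(** By planarity both classes span in the same direction, and transposition reduces the vertical
    case to the horizontal one. *)
Lemma cut_image F M E i x y a b : critical F M E i x a b ->
  cut F y -> y <> x -> cut F (cell M i y).
Proof.
move=> C cy yx; have [ax bx nab'] := critical_conn C.
have [T M1 fin iE [Fx Fa Fb] ix [ra rb] nab] := C.
have fixcell c : rest M E i F (cell M i c) -> forall j, j \in E ->
    cell M j x = x -> rest M E j F (cell M j c).
  by move=> rc j jE jx; rewrite (fixed_cell_unique T jE iE Fx Fx jx ix).
have sa := class_spans T M1 fin Fx (conj Fa ax) (conj Fb bx) nab' (fixcell a ra).
have sb := class_spans T M1 fin Fx (conj Fb bx) (conj Fa ax)
  (fun h => nab' (conn_sym h)) (fixcell b rb).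
case: sa sb => [ha|va] [hb|vb].
- exact: (cut_image_horizontal C ha hb).
- by case: nab'; exact: (spans_not_transverse T).
- by case: nab'; apply: conn_sym; exact: (spans_not_transverse T).
have S := @transpose_symmetry R M.
have flip c : spans_vertically F x c ->
    spans_horizontally (transpose @` F) (transpose x) (transpose c).
  move=> [l [r [cl cr l2 r2]]]; exists (transpose l), (transpose r).
  by split=> //; apply: (conn_symmetry S F x _ _).1.
apply/(cut_symmetry S F (cell M i y)); rewrite (sym_cell S); last exact: (tiling_lt T).
apply: (cut_image_horizontal (critical_symmetry S C) (flip a va) (flip b vb)).
  exact: (cut_symmetry S F y).2.
by move=> /(can_inj (sym_invol S)).
Qed.

(* Otherwise the iterated images of [y] in the cell [i] would be infinitely many
   cut points. *)
Lemma fixed_cut_unique F M E i x y : tiling M E F -> (1 < M)%N ->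
  finite_set (cut F) -> i \in E -> cell M i x = x -> cut F x -> cut F y -> y = x.
Proof.
move=> T M1 fin iE ix [Fx [a [b [Fa Fb nab]]]] cy; apply: contrapT => yx.
have M0 := tiling_gt0 T.
have iy : cell M i y <> y.
  move=> iy; have d0 : 0 < `|y - x| by rewrite normr_gt0 subr_eq0; apply/eqP.
  have := cell_dist M0 i y x; rewrite iy ix => /eqP.
  rewrite gt_eqF // ltr_pdivrMr ?ltr0n // ltr_pMr // ltr1n //.
have [n contacts] := fixed_contacts T M1 iE Fx ix Fa Fb nab.
(* The level [m] is large enough for contacts to exist, is positive, and sends [y] to a point that
   is not a cut point. *)
have [m nm ncut] := finite_escape n.+1 fin (iter_cell_inj M1 iy).
have [a' [b' [[Fa' Fb'] ra rb nab']]] := contacts m (ltnW nm).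
apply: ncut; rewrite -iter_cell //.
apply: (cut_image (x := x) (a := a') (b := b')) cy yx.
split=> //; first exact: (tiling_words M0 m T).
- by apply: expn_gt1 => //; lia.
- exact: word_pos_words.
- by rewrite iter_cell //; elim: (m) => //= k ->.
- by split.
Qed.

Definition digits N (D : {set 'I_N * 'I_N}) : seq (nat * nat) :=
  [seq (nat_of_ord k.1, nat_of_ord k.2) | k <- enum D].

Lemma digitsP N (D : {set 'I_N * 'I_N}) p :
  p \in digits D <-> exists2 k, k \in D & p = (nat_of_ord k.1, nat_of_ord k.2).
Proof.
split=> [/mapP[k]|[k iD ->]]; first by rewrite mem_enum => iD ->; exists k.
by apply/mapP; exists k => //; rewrite mem_enum.
Qed.

Lemma cellsP N (D : {set 'I_N * 'I_N}) F z :
  cells D F z <-> exists k f, [/\ k \in D, F f & z = phi k f].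
Proof.
split=> [[k /= iD [f Ff <-]]|[k [f [iD Ff ->]]]]; first by exists k, f.
by exists k => //; exists f.
Qed.

(** At a minimum of a coordinate, [N] times its value is at least that value, so it is nonnegative.
    At a maximum, [N] times the value exceeds it by at most [N - 1], so it is at most 1. *)
Lemma GSC_square N (D : {set 'I_N * 'I_N}) F : (1 < N)%N ->
  is_GSC D F -> F `<=` unit_square.
Proof.
move=> N1 [F0 cF FE].
have Nr : (1 : R) < N%:R by rewrite ltr1n.
have bound (c : R * R -> R) (dig : 'I_N * 'I_N -> nat) : continuous c ->
    (forall k, (dig k < N)%N) ->
    (forall k z, c (phi k z) = (c z + (dig k)%:R) / N%:R) ->
    forall z, F z -> 0 <= c z <= 1.
  move=> cc digN cphi z Fz.
  have cFc : {within F, continuous c} by exact: continuous_subspaceT.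
  have [m mF hm] := compact_EVT_min F0 cF cFc.
  have [w wF hw] := compact_EVT_max F0 cF cFc.
  have step t : t \in F -> exists k f, f \in F /\ c t * N%:R = c f + (dig k)%:R.
    rewrite inE {1}FE => /cellsP[k [f [_ Ff ->]]]; exists k, f.
    by rewrite inE cphi divfK // gt_eqF // (lt_trans ltr01).
  apply/andP; split.
    apply: le_trans (hm z _); last by rewrite inE.
    have [k [f [fF e]]] := step m mF; have := hm f fF.
    have : (0 : R) <= (dig k)%:R by [].
    nra.
  apply: le_trans (hw z _) _; first by rewrite inE.
  have [k [f [fF e]]] := step w wF; have := hw f fF.
  have : ((dig k).+1%:R : R) <= N%:R by rewrite ler_nat.
  rewrite -natr1; nra.
move=> z Fz; split.
- by have := bound _ (fun k => nat_of_ord k.1) continuous_coord1; apply.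
- by have := bound _ (fun k => nat_of_ord k.2) continuous_coord2; apply.
Qed.

Lemma GSC_tiling N (D : {set 'I_N * 'I_N}) F : (1 < N)%N ->
  is_GSC D F -> connected F -> tiling N (digits D) F.
Proof.
move=> N1 G nF; have [_ cF FE] := G; split=> //.
- exact: ltnW.
- by move=> p /digitsP[k _ ->] /=.
- move=> z; split.
    rewrite {1}FE => /cellsP[k [f [iD Ff ->]]].
    by exists (nat_of_ord k.1, nat_of_ord k.2), f; split=> //; apply/digitsP; exists k.
  move=> [p [f [/digitsP[k iD ->] Ff ->]]]; rewrite FE; apply/cellsP.
  by exists k, f.
- exact: (GSC_square N1 G).
Qed.

(** Otherwise each cell minus [x] lies in a single class. Splitting the digits by whether their cell
    meets the class of [a] gives two unions of cells that meet at most in [x], and do meet because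
    [F] is connected; so [F] would be fragile. *)
Lemma cut_point_pullback N (D : {set 'I_N * 'I_N}) F x : (1 < N)%N ->
  is_GSC D F -> connected F -> ~ fragile D F -> cut F x ->
  exists p z, [/\ p \in digits D, cut F z & x = cell N p z].
Proof.
move=> N1 G nF nfr [Fx [a [b [[Fa ax] [Fb bx] nab]]]].
have T := GSC_tiling N1 G nF; have [_ cF FE] := G.
apply: contrapT => no; apply: nfr.
have one k f g : k \in D -> F f -> F g -> phi k f <> x -> phi k g <> x ->
    conn F x (phi k f) (phi k g).
  move=> iD Ff Fg fx gx.
  have iE : (nat_of_ord k.1, nat_of_ord k.2) \in digits D by apply/digitsP; exists k.
  have [[z Fz zx]|nz] := pselect (exists2 z, F z & phi k z = x).
    rewrite -zx; apply: (conn_cell T iE); apply: contrapT => nfg; apply: no.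
    exists (nat_of_ord k.1, nat_of_ord k.2), z; split=> //; split=> //; exists f, g.
    by split=> //; split=> // E; [apply: fx|apply: gx]; rewrite E.
  exists (phi k @` F); split.
  - by apply: compact_image cF;
    exact: (@continuous_cell R N (nat_of_ord k.1, nat_of_ord k.2)).
  - by apply: connected_image nF;
    exact: (@continuous_cell R N (nat_of_ord k.1, nat_of_ord k.2)).
  - move=> _ [w Fw <-]; split; last by move=> wx; apply: nz; exists w.
    exact: (tiling_cell T iE).
  - by exists f.
  - by exists g.
pose P (k : 'I_N * 'I_N) :=
  `[< exists f, [/\ F f, phi k f <> x & conn F x a (phi k f)] >].
pose D1 := [set k in D | P k]%SET; pose D2 := [set k in D | ~~ P k]%SET.
have D1a k f : k \in D1 -> F f -> phi k f <> x -> conn F x a (phi k f).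
  rewrite inE => /andP[iD /asboolP[g [Fg gx ag]]] Ff fx.
  exact: conn_trans ag (one _ _ _ iD Fg Ff gx fx).
have D2a k f : k \in D2 -> F f -> phi k f <> x -> ~ conn F x a (phi k f).
  by rewrite inE => /andP[iD /asboolP nP] Ff fx af; apply: nP; exists f.
have D12 z : F z -> z <> x ->
    (conn F x a z -> cells D1 F z) /\ (~ conn F x a z -> cells D2 F z).
  rewrite {1}FE => /cellsP[k [f [iD Ff ->]]] fx; split=> af; apply/cellsP;
    exists k, f; split=> //; rewrite inE iD /=; first by apply/asboolP; exists f.
  apply/asboolP => -[g [Fg gx ag]]; apply: af.
  exact: conn_trans ag (one _ _ _ iD Fg Ff gx fx).
have closed_cells (D' : {set 'I_N * 'I_N}) : closed (cells D' F).
  have -> : cells D' F = cells_seq N (digits D') F.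
    apply/seteqP; split=> z.
      move=> /cellsP[k [f [iD Ff ->]]]; exists (nat_of_ord k.1, nat_of_ord k.2), f.
      by split=> //; apply/digitsP; exists k.
    by move=> [p [f [/digitsP[k iD ->] Ff ->]]]; apply/cellsP; exists k, f.
  by apply: compact_closed_plane; apply: compact_cells_seq => //; exact: ltnW.
have only z : cells D1 F z -> cells D2 F z -> z = x.
  move=> /cellsP[k [f [iD Ff zf]]] /cellsP[j [g [jD Fg zg]]].
  apply: contrapT => zx; apply: (D2a j g) => //; rewrite -zg // zf.
  by apply: D1a => //; rewrite -zf.
exists D1, D2; split.
- by apply/setP => k; rewrite !inE; case: (k \in D); case: (P k).
- by apply/setP => k; rewrite !inE; case: (k \in D); case: (P k).
exists x; suff [z [z1 z2]] : exists z, cells D1 F z /\ cells D2 F z.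
  have zx := only _ z1 z2; rewrite zx in z1 z2.
  by apply/seteqP; split=> [w [w1 w2]|w ->] //; exact: only.
apply: contrapT => disj.
have Ca : cells D1 F a by apply: (D12 a Fa ax).1; exact: conn_refl.
have Cb : cells D2 F b by apply: (D12 b Fb bx).2.
apply: (disj); exists b; split=> //.
apply: (connected_split nF (closed_cells D1) (closed_cells D2) _ _ Fa Ca) Fb.
- move=> z; rewrite {1}FE => /cellsP[k [f [iD Ff ->]]].
  have [Pi|nPi] := boolP (P k); [left|right]; apply/cellsP; exists k, f;
    by rewrite inE iD.
- by move=> z _ z1 z2; apply: disj; exists z.
Qed.

(** Iterated pullbacks of [x0] stay in the finite set of cut points, so two of them coincide; the
    digits read between them form the word of a cell fixing that point. *)
Lemma exists_fixed_cut N (D : {set 'I_N * 'I_N}) F x0 : (1 < N)%N ->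
  is_GSC D F -> connected F -> ~ fragile D F -> finite_set (cut F) -> cut F x0 ->
  exists n i x, [/\ (0 < n)%N, i \in words N (digits D) n, cut F x &
    cell (N ^ n) i x = x].
Proof.
move=> N1 G nF nfr fin cx0; have N0 := ltnW N1.
(* The condition [cut F x] stands under the existential, so [choice] gives a total function with a
   dummy value at the other points. *)
have pullback x : exists pz : (nat * nat) * (R * R), cut F x ->
    [/\ pz.1 \in digits D, cut F pz.2 & x = cell N pz.1 pz.2].
  have [cx|ncx] := pselect (cut F x); last by exists ((0, 0)%N, x).
  have [p [z h]] := cut_point_pullback N1 G nF nfr cx.
  by exists (p, z).
have [t ht] := choice pullback.
pose s n := iter n (fun x => (t x).2) x0.
have cs n : cut F (s n) by elim: n => // n /ht[].
have [k [l [kl skl]]] : exists k l, (k < l)%N /\ s k = s l.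
  apply: contrapT => no.
  have inj : injective s.
    move=> k l skl; have [kl|lk|//] := ltngtP k l.
      by case: no; exists k, l.
    by case: no; exists l, k.
  by have [n _] := finite_escape 0 fin inj; apply; exact: cs.
exists (l - k)%N, (word_pos N (fun m => (t (s (k + m)%N)).1) (l - k)), (s k).
split; first by rewrite subn_gt0.
- by apply: word_pos_words => j _; have [] := ht _ (cs (k + j)%N).
- exact: cs.
have := @cell_word_pos R N N0 (fun m => (t (s (k + m)%N)).1) (fun m => s (k + m)%N)
  (l - k)%N.
rewrite addn0 subnKC ?(ltnW kl) // -skl => <- // j _.
by have [_ _] := ht _ (cs (k + j)%N); rewrite addnS.
Qed.

End Carpets.

Theorem theorem1p5 (R : realType) (N : nat) (D : {set 'I_N * 'I_N})
    (F : set (R * R)) (hN : (2 <= N)%N)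
    (hD : (1 < #|D| < N ^ 2)%N)
    (hF : is_GSC D F) (hconn : connected F) (hfrag : ~ fragile D F)
    (hcut : (`I_2 #<= cut_points F)%card) :
  infinite_set (cut_points F).
Proof.
have T := GSC_tiling hN hF hconn.
have cutE : cut_points F = cut F.
  by apply/seteqP; split=> z /(cut_pointsP T hN).
rewrite cutE in hcut * => fin.
have [f] := @pcard_leP _ _ _ _ hcut.
have c0 : cut F (f 0%N) by apply: funS.
have c1 : cut F (f 1%N) by apply: funS.
have [n [i [x [n0 iE cx ix]]]] := exists_fixed_cut hN hF hconn hfrag fin c0.
(* At level [n] a single cell map fixes [x], so every cut point equals [x], against the two distinct
   values of [f]. *)
have Tn := tiling_words (ltnW hN) n T.
have uniq y : cut F y -> y = x.
  by apply: (fixed_cut_unique Tn (expn_gt1 hN n0) fin iE ix cx).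
have /inj : f 0%N = f 1%N by rewrite (uniq _ c0) (uniq _ c1).
by rewrite !inE /= => /(_ isT isT).
Qed.
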